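(* Let $D$ be a weakly locally finite division ring with center $F$. Then every non-central almost subnormal subgroup of $D^*$ (i.e. one not contained in $F^*$) contains a non-cyclic free subgroup.
   Context: A division ring $D$ is weakly locally finite if every finite subset of $D$ generates a division subring that is finite-dimensional over its own center. $D^*$ is the multiplicative group of $D$. A subgroup $H$ of a group $K$ is almost subnormal in $K$ if there is a chain of subgroups $H=H_r\le H_{r-1}\le\cdots\le H_1=K$ such that for each $1<i\le r$, either $H_i$ is normal in $H_{i-1}$ or $H_i$ has finite index in $H_{i-1}$. *)

(* Defs.v *)
From mathcomp Require Import all_boot all_order all_algebra.
Set Implicit Arguments. Unset Strict Implicit. Unset Printing Implicit Defensive.
Import GRing.Theory.
Local Open Scope ring_scope.

Section Defs.
Variable D : unitRingType.

(* D is a division ring: every nonzero element is invertible (1 != 0 is part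
   of unitRingType). *)
Definition is_division_ring : Prop := forall x : D, x != 0 -> x \is a GRing.unit.

Definition central (x : D) : Prop := forall y : D, x * y = y * x.

Definition is_divsubring (S : D -> Prop) : Prop :=
  [/\ S 0, S 1,
      (forall x y, S x -> S y -> S (x - y)),
      (forall x y, S x -> S y -> S (x * y)) &
      (forall x, S x -> x != 0 -> S x^-1)].

Definition gen_divring (s : seq D) (x : D) : Prop :=
  forall S : D -> Prop, is_divsubring S -> (forall y, y \in s -> S y) -> S x.

Definition center_of (K : D -> Prop) (x : D) : Prop :=
  K x /\ forall y, K y -> x * y = y * x.

Definition findim_over_center (K : D -> Prop) : Prop :=
  exists b : seq D, (forall i, i \in b -> K i) /\
    forall y, K y -> exists c : seq D,
      [/\ size c = size b, (forall z, z \in c -> center_of K z) &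
          y = \sum_(i < size b) c`_i * b`_i].

Definition weakly_locally_finite : Prop :=
  forall s : seq D, findim_over_center (gen_divring s).

Definition unitgroup (x : D) : Prop := x \is a GRing.unit.

(* H is a subgroup of K (both subsets of D^*, K assumed a group) *)
Definition is_subgroup_of (H K : D -> Prop) : Prop :=
  [/\ (forall x, H x -> K x), H 1,
      (forall x y, H x -> H y -> H (x * y)) &
      (forall x, H x -> H x^-1)].

Definition normal_in (H K : D -> Prop) : Prop :=
  forall k h, K k -> H h -> H (k^-1 * h * k).

Definition finite_index_in (H K : D -> Prop) : Prop :=
  exists s : seq D, (forall t, t \in s -> K t) /\
    forall k, K k -> exists2 t, t \in s & H (k * t^-1).

Definition almost_subnormal (H : D -> Prop) : Prop :=
  exists (r : nat) (c : nat -> D -> Prop),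
    [/\ (forall x, c 0%N x <-> unitgroup x),
        (forall x, c r x <-> H x) &
        (forall i, (i < r)%N ->
           is_subgroup_of (c i.+1) (c i) /\
           (normal_in (c i.+1) (c i) \/ finite_index_in (c i.+1) (c i)))].

Definition eval_word (w : seq (D * bool)) : D :=
  \prod_(l <- w) (if l.2 then l.1^-1 else l.1).

Fixpoint reduced_word (w : seq (D * bool)) : bool :=
  match w with
  | l1 :: ((l2 :: _) as w') =>
      ~~ ((l1.1 == l2.1) && (l1.2 != l2.2)) && reduced_word w'
  | _ => true
  end.

Definition free_basis (X : D -> Prop) : Prop :=
  forall w : seq (D * bool), w != [::] -> reduced_word w ->
    (forall l, l \in w -> X l.1) -> eval_word w != 1.

Definition contains_noncyclic_free (H : D -> Prop) : Prop :=
  exists X : D -> Prop,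
    [/\ (forall x, X x -> H x /\ unitgroup x),
        (exists a b, [/\ X a, X b & a != b]) &
        free_basis X].

End Defs.

(* Main.v *)
(* Idea. Pick a in H and c not commuting with a. The division ring generated
   by a and c is finite-dimensional over its centre F. A valuation ring of F,
   with residue field k algebraic over a prime field F_p and such that
   finitely many prescribed elements of F are units, reduces this division
   ring to a finite-dimensional prime k-algebra R in which a stays invertible
   and non-central. By Wedderburn's little theorem R is not a domain, so it has
   orthogonal primitive idempotents e_0, e_1, and these can be moved until
   all e_i a e_j and e_i a^-1 e_j are nonzero. Write g ~ z when some nonzero
   central multiple of g reduces to z. Lifting 1 - e_1 and 1 - e_0 to u_1, u_0,
   the element x = u_1^-1 u_0 satisfies x ~ z_1 in e_1 R e_1 and
   x^-1 ~ z_0 in e_0 R e_0. Hence g = [a, x] and g^-1 reduce to a^-1 z and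
   z' a, with z, z' nonzero in e_0 R e_1. This shape is kept by g |-> [a, g]
   and by positive powers, so going down an almost subnormal chain yields such
   an element in H; exchanging x and x^-1 yields a second one, with e_1 R e_0 in
   place of e_0 R e_1. A reduced word in the two elements reduces, up to the
   units a and a^-1 on both sides, to a nonzero element of some e_i R e_j, which
   is not invertible; so the word is not 1. *)
From HB Require Import structures.
Require Import Defs.
From mathcomp Require Import all_boot all_order all_algebra all_field.
From mathcomp Require Import boolp classical_sets zify.
Set Implicit Arguments. Unset Strict Implicit. Unset Printing Implicit Defensive.
Import GRing.Theory.
Local Open Scope classical_set_scope.
Local Open Scope ring_scope.

(** * Finite domains *)

(** A division ring has no idempotents besides 0 and 1, and its reduction may well be a division
    ring again. Algebraicity of k over F_p excludes this: only finitely many scalars enter the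
    product of two given elements, they lie in a finite field, and a domain of this kind is
    commutative. Primeness of R is not automatic either. It rests on the Artin-Whaples theorem: each
    coordinate function of the division ring over its centre has the form x |-> sum of u x v with
    finitely many u and v, and this identity survives reduction as soon as all u and v are integral.
    So the elements prescribed as units include the nonzero coordinates of these u and v, the
    structure constants, and the coordinates of a, a^-1, c and of the inverse of ac - ca, which
    keeps a non-central. They also include the differences of 17 elements of F, so that k has 17
    elements: the general position argument excludes at most 16 scalars. The relation ~ is
    multiplicative only and allows a central factor, because x and x^-1 must be rescaled separately:
    their reductions z_1 and z_0 have product 0. *)

Section FiniteDomain.
Variables (R : nzRingType) (s : seq R).
Hypotheses (s1 : 1 \in s) (sB : {in s &, forall x y, x - y \in s})
  (sM : {in s &, forall x y, x * y \in s})
  (s_dom : {in s &, forall x y, x * y = 0 -> (x == 0) || (y == 0)}).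

Definition finite_subring_pred : {pred R} := fun x => x \in s.
Local Notation S := finite_subring_pred.

Let S_subring : subring_closed S.
Proof. by split=> [|x y|x y]; rewrite ?inE; [exact: s1 | exact: sB | exact: sM]. Qed.

HB.instance Definition _ := GRing.isSubringClosed.Build R S S_subring.

Definition finite_subring_type := {x : R | S x}.
Local Notation T := finite_subring_type.
HB.instance Definition _ := SubChoice.on T.
HB.instance Definition _ := [SubChoice_isSubNzRing of T by <:].

Let e : seq T := pmap insub s.

Let mem_e (x : T) : x \in e.
Proof.
rewrite mem_pmap; apply/mapP; exists (val x); last by rewrite valK.
exact: (valP x).
Qed.

Let e_indexK : cancel (index^~ e) (fun i => nth 0 e i).
Proof. by move=> x; rewrite nth_index. Qed.

HB.instance Definition _ := Choice_isCountable.Build T (can_pcan e_indexK).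

Let T_enum : Finite.axiom (undup e).
Proof.
by move=> x; rewrite count_uniq_mem ?undup_uniq // mem_undup mem_e.
Qed.

HB.instance Definition _ := isFinite.Build T T_enum.
HB.instance Definition _ := FinRing.isNzRing.Build T.

(** Wedderburn's little theorem for a finite subring of a ring that may be infinite and have zero
    divisors elsewhere: the list [s] is turned into a finite ring type. *)
Lemma finite_domain_mulrC : {in s &, forall x y, x * y = y * x}.
Proof.
move=> x y xs ys.
have dom : GRing.integral_domain_axiom T.
  move=> u v /(congr1 val); rewrite rmorphM rmorph0 => /(s_dom (valP u) (valP v)).
  by rewrite -!val_eqE.
pose u : T := exist _ x xs; pose v : T := exist _ y ys.
exact: (congr1 val (finDomain_mulrC dom u v)).
Qed.

End FiniteDomain.

(** * Places *)

Section PartialMorphisms.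
Variables (F : fieldType) (L : closedFieldType).
Implicit Types (G : set (F * L)) (p : {poly F}) (q : {poly L}).

(* A subring of F x L that is the graph of a partial function, i.e. a ring
   morphism to L defined on a subring of F. *)
Definition partial_morphism G : Prop :=
  [/\ G (1, 1),
      forall x y a b, G (x, a) -> G (y, b) -> G (x - y, a - b),
      forall x y a b, G (x, a) -> G (y, b) -> G (x * y, a * b) &
      forall a, G (0, a) -> a = 0].

Definition place G : Prop := partial_morphism G /\
  forall x, (exists a, G (x, a)) \/ G (x^-1, 0).

Definition graph_poly G p q : Prop := forall i, G (p`_i, q`_i).

Section Theory.
Variable G : set (F * L).
Hypothesis pmG : partial_morphism G.

Lemma graph1 : G (1, 1). Proof. by case: pmG. Qed.

Lemma graphB x y a b : G (x, a) -> G (y, b) -> G (x - y, a - b).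
Proof. by case: pmG => _ + _ _; exact. Qed.

Lemma graphM x y a b : G (x, a) -> G (y, b) -> G (x * y, a * b).
Proof. by case: pmG => _ _ + _; exact. Qed.

Lemma graph0 : G (0, 0).
Proof. by have := graphB graph1 graph1; rewrite !subrr. Qed.

Lemma graphD x y a b : G (x, a) -> G (y, b) -> G (x + y, a + b).
Proof.
by move=> Gx /(graphB graph0); rewrite !sub0r => /(graphB Gx); rewrite !opprK.
Qed.

Lemma graph_fun x a b : G (x, a) -> G (x, b) -> a = b.
Proof.
case: pmG => _ _ _ fG /graphB/[apply]; rewrite subrr => /fG/eqP.
by rewrite subr_eq0 => /eqP.
Qed.

Lemma graph0P a : G (0, a) -> a = 0. Proof. by move/graph_fun; apply; exact: graph0. Qed.

Lemma graphX x a n : G (x, a) -> G (x ^+ n, a ^+ n).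
Proof.
by move=> Gx; elim: n => [|n IH]; rewrite ?expr0 ?exprS; [exact: graph1 | exact: graphM].
Qed.

Lemma graph_sum (I : Type) (r : seq I) (P : pred I) (f : I -> F) (g : I -> L) :
  (forall i, P i -> G (f i, g i)) ->
  G (\sum_(i <- r | P i) f i, \sum_(i <- r | P i) g i).
Proof.
move=> Gfg; apply: (big_ind2 (fun x a => G (x, a))) => //; first exact: graph0.
by move=> *; exact: graphD.
Qed.

Lemma graph_polyB p1 q1 p2 q2 :
  graph_poly G p1 q1 -> graph_poly G p2 q2 -> graph_poly G (p1 - p2) (q1 - q2).
Proof. by move=> G1 G2 i; rewrite !coefB; exact: graphB. Qed.

Lemma graph_polyM p1 q1 p2 q2 :
  graph_poly G p1 q1 -> graph_poly G p2 q2 -> graph_poly G (p1 * p2) (q1 * q2).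
Proof.
by move=> G1 G2 i; rewrite !coefM; apply: graph_sum => j _; exact: graphM.
Qed.

Lemma graph_polyC x a : G (x, a) -> graph_poly G x%:P a%:P.
Proof. by move=> Gx i; rewrite !coefC; case: eqP => // _; exact: graph0. Qed.

Lemma graph_polyXn n : graph_poly G 'X^n 'X^n.
Proof.
by move=> i; rewrite !coefXn; case: eqP => _; [exact: graph1 | exact: graph0].
Qed.

(** The subring of F x L generated by [G] and the pair (x, w): a pair (p, q) with [graph_poly G p q]
    is a polynomial with coefficients in [G]. *)
Definition adjoin_graph (x : F) (w : L) : set (F * L) :=
  [set z | exists p q, [/\ graph_poly G p q, z.1 = p.[x] & z.2 = q.[w]]].

Lemma adjoin_graph_sub x w : G `<=` adjoin_graph x w.
Proof.
move=> [y a] Gy; exists y%:P, a%:P; rewrite !hornerC; split=> //.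
exact: graph_polyC.
Qed.

Lemma adjoin_graph_mem x w : adjoin_graph x w (x, w).
Proof.
by exists 'X, 'X; rewrite !hornerX; split=> //; exact: (graph_polyXn 1).
Qed.

Lemma adjoin_graph_morphism x w :
  (forall p q, graph_poly G p q -> p.[x] = 0 -> q.[w] = 0) ->
  partial_morphism (adjoin_graph x w).
Proof.
move=> xw; split.
- exact/adjoin_graph_sub/graph1.
- move=> _ _ _ _ [p1 [q1 [G1 /= -> ->]]] [p2 [q2 [G2 /= -> ->]]].
  exists (p1 - p2), (q1 - q2); rewrite !hornerE; split=> //.
  exact: graph_polyB.
- move=> _ _ _ _ [p1 [q1 [G1 /= -> ->]]] [p2 [q2 [G2 /= -> ->]]].
  exists (p1 * p2), (q1 * q2); rewrite !hornerE; split=> //.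
  exact: graph_polyM.
- by move=> a [p [q [Gpq /= p0 ->]]]; apply: xw Gpq _.
Qed.

End Theory.

Section Maximal.
Variable G : set (F * L).
Hypothesis pmG : partial_morphism G.
Hypothesis maxG : forall G', G `<=` G' -> partial_morphism G' -> G' `<=` G.

Let adjoin x w :
  (forall p q, graph_poly G p q -> p.[x] = 0 -> q.[w] = 0) -> G (x, w).
Proof.
move=> xw; apply: (maxG (@adjoin_graph_sub _ pmG x w)); last first.
  exact: adjoin_graph_mem.
exact: adjoin_graph_morphism.
Qed.

(** Maximality makes the domain a local ring. A relation p(1/r) = 0 multiplied by a power of r
    becomes a relation inside the domain, whose image is a power of a times q(1/a). *)
Let inv r a : G (r, a) -> a != 0 -> G (r^-1, a^-1).
Proof.
move=> Gra a0; have r0 : r != 0.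
  by apply: contraNneq a0 => r0; rewrite r0 in Gra; rewrite (graph0P pmG Gra).
apply: adjoin => p q Gpq pr.
pose n := maxn (size p) (size q).
have hp : r ^+ n * p.[r^-1] = \sum_(i < n) p`_i * r ^+ (n - i).
  rewrite (@horner_coef_wide _ n) ?leq_maxl // mulr_sumr; apply: eq_bigr => i _.
  by rewrite mulrCA exprVn -expfB.
have hq : a ^+ n * q.[a^-1] = \sum_(i < n) q`_i * a ^+ (n - i).
  rewrite (@horner_coef_wide _ n) ?leq_maxr // mulr_sumr; apply: eq_bigr => i _.
  by rewrite mulrCA exprVn -expfB.
have : G (r ^+ n * p.[r^-1], a ^+ n * q.[a^-1]).
  rewrite hp hq; apply: graph_sum => // i _; apply: graphM => //; exact: graphX.
rewrite pr mulr0 => /(graph0P pmG)/eqP; rewrite mulf_eq0 expf_eq0 (negPf a0) andbF /=.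
by move/eqP.
Qed.

(* Otherwise the reductions of the polynomial relations satisfied by x would
   have a common root w in L, and the morphism could be extended by x |-> w. *)
Let no_value x : (forall w, ~ G (x, w)) ->
  exists2 p, graph_poly G p 1 & p.[x] = 0.
Proof.
move=> nGx.
pose J q := exists2 p, graph_poly G p q & p.[x] = 0.
have rootJ w : exists2 q, J q & q.[w] != 0.
  apply: contrapT => nJ; apply: (nGx w); apply: adjoin => p q Gpq px.
  by apply: contrapT => /eqP qw; apply: nJ; exists q => //; exists p.
have [q [Jq q0 minq]] : exists q, [/\ J q, q != 0 &
    forall q', J q' -> q' != 0 -> (size q <= size q')%N].
  have [q0 Jq0 q00] := rootJ 0.
  have ex : exists n, `[< exists2 q, J q & (q != 0) && (size q == n)>].
    exists (size q0); apply/asboolP; exists q0 => //; rewrite eqxx andbT.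
    by apply: contraNneq q00 => ->; rewrite horner0.
  case: (ex_minnP ex) => m /asboolP[q Jq /andP[qn0 /eqP sq]] minm.
  exists q; split=> // q' Jq' q'0; rewrite sq; apply: minm; apply/asboolP.
  by exists q' => //; rewrite q'0 eqxx.
have [p Gpq px] := Jq.
have lc0 : lead_coef q != 0 by rewrite lead_coef_eq0.
have Glc := inv (Gpq _) lc0.
(* Euclidean division by [q] is done by hand, since each quotient term must lift to the domain of
   [G]; [Glc] provides the inverse of the leading coefficient there. *)
have dvdJ n : forall q', (size q' <= n)%N -> J q' -> q %| q'.
  elim: n => [|n IH] q' sq' Jq'.
    by move: sq'; rewrite leqn0 size_poly_eq0 => /eqP ->; rewrite dvdp0.
  have [->|q'0] := eqVneq q' 0; first by rewrite dvdp0.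
  have sqq' := minq q' Jq' q'0.
  have [p' Gpq' p'x] := Jq'.
  pose d := (size q' - size q)%N.
  pose u : {poly L} := (lead_coef q' / lead_coef q)%:P * 'X^d.
  pose v : {poly F} := (p'`_(size q').-1 * (p`_(size q).-1)^-1)%:P * 'X^d.
  have Guv : graph_poly G v u.
    apply: graph_polyM => //; last exact: graph_polyXn.
    by apply: graph_polyC => //; apply: graphM.
  have -> : q' = (q' - u * q) + u * q by rewrite subrK.
  apply: dvdp_add; last exact: dvdp_mull.
  apply: IH; last first.
    exists (p' - v * p); last by rewrite !hornerE px p'x mulr0 subrr.
    by apply: graph_polyB => //; apply: graph_polyM.
  have su : size (u * q) = size q'.
    rewrite mulrC size_proper_mul; last first.
      by rewrite lead_coefM lead_coefXn lead_coefC mulr1 !mulf_neq0 ?invr_eq0 ?lead_coef_eq0.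
    rewrite size_Cmul ?size_polyXn; last by rewrite mulf_neq0 ?invr_eq0 ?lead_coef_eq0.
    by rewrite addnS /= addnC subnK.
  rewrite -ltnS; apply: leq_trans sq'.
  have sq'0 : (0 < size q')%N by rewrite size_poly_gt0.
  rewrite -(prednK sq'0) ltnS; apply/leq_sizeP => j.
  rewrite leq_eqVlt coefB => /orP[/eqP <-|lt]; last first.
    by rewrite (prednK sq'0) in lt; rewrite !nth_default ?subrr ?su.
  have -> : (u * q)`_(size q').-1 = lead_coef q'.
    rewrite -su -lead_coefE lead_coefM.
    by rewrite lead_coefM lead_coefXn lead_coefC mulr1 divfK.
  exact: subrr.
have /eqP sq1 : size q == 1.
  apply/negPn/negP => /closed_rootP[w qw].
  have [q' Jq' /negP] := rootJ w; apply.
  by rewrite -rootE -dvdp_XsubCl (dvdp_trans _ (dvdJ _ _ (leqnn _) Jq')) // dvdp_XsubCl.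
have qC : q = (lead_coef q)%:P by rewrite lead_coefE sq1 [LHS]size1_polyC ?sq1.
exists ((p`_(size q).-1)^-1%:P * p); last by rewrite !hornerE px mulr0.
have -> : 1 = (lead_coef q)^-1%:P * q by rewrite [X in _ * X]qC -polyCM mulVf.
by apply: graph_polyM => //; exact: graph_polyC.
Qed.

(** The descent behind the existence of valuation rings. Both relations have constant term reducing
    to 1 and all other coefficients reducing to 0. The shorter one, multiplied by a power of x,
    cancels the leading term of the longer one and leaves its reduction unchanged, so the total size
    drops. *)
Let no_relations n (x : F) (p q : {poly F}) : (size p + size q <= n)%N -> x != 0 ->
  graph_poly G p 1 -> graph_poly G q 1 -> p.[x] = 0 -> q.[x^-1] = 0 -> False.
Proof.
have pm1 (r : {poly F}) y : graph_poly G r 1 -> r.[y] = 0 -> (1 < size r)%N.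
  move=> Gr ry; rewrite ltnNge; apply/negP => /size1_polyC rC.
  move: ry; rewrite rC hornerC => r0; have := Gr 0; rewrite r0 coef1 /=.
  by move/(graph0P pmG)/eqP; rewrite oner_eq0.
elim: n x p q => [|n IH] x p q.
  by move=> + _ Gp _ px; have := pm1 _ _ Gp px; case: (size p).
wlog sqp : x p q / (size q <= size p)%N => [wl|].
  case: (leqP (size q) (size p)) => [|/ltnW] le s x0 Gp Gq px qx.
    exact: (wl x p q).
  apply: (wl x^-1 q p) => //; rewrite ?invrK ?invr_eq0 //.
  by rewrite addnC.
move=> spq x0 Gp Gq px qx.
have sp := pm1 _ _ Gp px; have sq := pm1 _ _ Gq qx.
have q0 : G ((q`_0)^-1, 1).
  by have := inv (Gq 0); rewrite coef1 /= invr1; apply; rewrite oner_eq0.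
have lp : G (p`_(size p).-1, 0).
  by have := Gp (size p).-1; rewrite coef1; case: (size p) sp => [|[]].
pose m := (size q).-1; pose rq := \poly_(i < size q) q`_(m - i).
pose v := (p`_(size p).-1 * (q`_0)^-1)%:P * 'X^(size p - size q).
have rqx : rq.[x] = 0.
  have -> : rq.[x] = x ^+ m * q.[x^-1]; last by rewrite qx mulr0.
  rewrite horner_poly horner_coef mulr_sumr (reindex_inj rev_ord_inj) /=.
  apply: eq_bigr => i _.
  have im : (i <= m)%N by rewrite -ltnS /m prednK ?ltn_ord // ltnW.
  have -> : (size q - i.+1 = m - i)%N by rewrite /m -subn1 -subnDA add1n.
  by rewrite subKn // mulrCA exprVn -expfB_cond ?(negPf x0) //.
have Gv : graph_poly G v 0.
  rewrite -(mul0r 'X^(size p - size q)) -polyC0; apply: graph_polyM => //.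
    by apply: graph_polyC => //; have := graphM pmG lp q0; rewrite mul0r.
  exact: graph_polyXn.
have Grq : graph_poly G rq (\poly_(i < size q) (1 : {poly L})`_(m - i)).
  by move=> i; rewrite !coef_poly; case: ifP => // _; exact: graph0.
have Gp' : graph_poly G (p - v * rq) 1.
  rewrite -[1]subr0 -(mul0r (\poly_(i < size q) (1 : {poly L})`_(m - i))).
  by apply: graph_polyB => //; apply: graph_polyM.
apply: (IH x (p - v * rq) q) => //; last by rewrite !hornerE px rqx mulr0 subrr.
rewrite -ltnS; apply: leq_trans spq; rewrite ltn_add2r.
have srq : (size rq <= size q)%N by exact: size_poly.
have coefv j : (v * rq)`_(j + (size p - size q)) = p`_(size p).-1 * (q`_0)^-1 * rq`_j.
  rewrite /v -mulrA coefCM; congr (_ * _).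
  by rewrite mulrC coefMXn ltnNge leq_addl /= addnK.
rewrite -[X in (_ < X)%N](@prednK (size p)) ?(ltnW sp) // ltnS.
apply/leq_sizeP => j sj; rewrite coefB.
have dj : (size p - size q <= j)%N by lia.
rewrite -(subnK dj) coefv subnK // coef_poly.
case: ltnP => [lt|ge]; last first.
  rewrite mulr0 subr0 nth_default //.
  by rewrite -(subnK dj) -[leqLHS](subnKC sqp) leq_add2r.
have jE : j = (size p).-1 by lia.
have -> : (m - (j - (size p - size q)) = 0)%N by rewrite /m; lia.
rewrite -jE mulfVK ?subrr //; apply/eqP => q00.
by have := Gq 0; rewrite q00 coef1 => /(graph0P pmG)/eqP; rewrite oner_eq0.
Qed.

Lemma maximal_place : place G.
Proof.
split=> // x.
have [[a Gx]|nGx] := pselect (exists a, G (x, a)); [by left; exists a | right].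
have x0 : x != 0.
  by apply/eqP => x0; apply: nGx; exists 0; rewrite x0; exact: graph0.
have [[a Gx]|nGx'] := pselect (exists a, G (x^-1, a)).
  have [a0|a0] := eqVneq a 0; first by rewrite -a0.
  by case: nGx; exists a^-1; rewrite -[x]invrK; exact: inv.
have [p Gp px] : exists2 p, graph_poly G p 1 & p.[x] = 0.
  by apply: no_value => w Gx; apply: nGx; exists w.
have [q Gq qx] : exists2 p, graph_poly G p 1 & p.[x^-1] = 0.
  by apply: no_value => w Gx; apply: nGx'; exists w.
by have := no_relations (leqnn _) x0 Gp Gq px qx.
Qed.

End Maximal.

Lemma place_extension G : partial_morphism G -> exists2 G', G `<=` G' & place G'.
Proof.
move=> pmG.
pose P G' := G' = set0 \/ (G `<=` G' /\ partial_morphism G').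
have [|A [PA maxA]] := @Zorn_bigcup _ P.
  move=> C CP Ctot.
  have [[A CA [x Ax]]|nC] := pselect (exists2 A, C A & exists x, A x); last first.
    left; apply/seteqP; split=> x // [A CA Ax].
    by apply: nC; exists A => //; exists x.
  have P' B z : C B -> B z -> G `<=` B /\ partial_morphism B.
    by move=> CB Bz; case: (CP B CB) => // B0; rewrite B0 in Bz.
  right; split.
    by move=> z Gz; exists A => //; case: (P' _ _ CA Ax) => + _; apply.
  have two z1 z2 : (\bigcup_(X in C) X) z1 -> (\bigcup_(X in C) X) z2 ->
      exists B, [/\ C B, B z1, B z2 & partial_morphism B].
    move=> [B1 C1 B1z] [B2 C2 B2z].
    have [B12|B21] := Ctot _ _ C1 C2.
      by exists B2; split=> //; [exact: B12 | case: (P' _ _ C2 B2z)].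
    by exists B1; split=> //; [exact: B21 | case: (P' _ _ C1 B1z)].
  split.
  - by exists A => //; case: (P' _ _ CA Ax) => _ /graph1.
  - move=> x1 y1 a b zx zy; have [B [CB Bx By pB]] := two _ _ zx zy.
    by exists B => //; exact: graphB.
  - move=> x1 y1 a b zx zy; have [B [CB Bx By pB]] := two _ _ zx zy.
    by exists B => //; exact: graphM.
  - by move=> a [B CB Ba]; case: (P' _ _ CB Ba) => _ /graph0P; apply.
have [GA pmA] : G `<=` A /\ partial_morphism A.
  case: PA => // A0; case: (maxA G); last by right; split=> // ?.
  split; first by rewrite A0 => ?.
  by move=> GA; have := GA _ (graph1 pmG); rewrite A0.
exists A => //; apply: maximal_place => // G' AG' pmG' z G'z.
apply: contrapT => nAz; apply: (maxA G'); last first.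
  by right; split=> //; exact: subset_trans GA AG'.
by split=> // G'A; exact/nAz/G'A.
Qed.

End PartialMorphisms.

Section PlaceTheory.
Variables (F : fieldType) (L : closedFieldType) (G : set (F * L)).
Hypothesis plG : place G.

Lemma place_inv r a : G (r, a) -> a != 0 -> G (r^-1, a^-1).
Proof.
have [pmG val] := plG; move=> Gr a0.
have r0 : r != 0.
  by apply: contraNneq a0 => r0; rewrite r0 in Gr; rewrite (graph0P pmG Gr).
have [[b Grb]|] := val r^-1.
  suff -> : a^-1 = b by [].
  have := graphM pmG Gr Grb; rewrite mulfV // => /(graph_fun pmG (graph1 pmG)) ab.
  by rewrite -[LHS]mulr1 ab mulKf.
rewrite invrK => /(graph_fun pmG Gr) a00; by rewrite a00 eqxx in a0.
Qed.

Definition place_unit x := exists2 a, G (x, a) & a != 0.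

(* Dividing a relation of x by its leading term: if x were not in the domain,
   1/x would be sent to 0. *)
Lemma place_root_lead (p : {poly F}) x : p != 0 -> p.[x] = 0 ->
  (forall i, p`_i != 0 -> place_unit p`_i) -> exists a, G (x, a).
Proof.
have [pmG val] := plG.
move=> p0 px pu; have [//|Gx] := val x.
have [->|x0] := eqVneq x 0; first by exists 0; exact: graph0.
have [a Ga a0] : place_unit (lead_coef p).
  by apply: pu; rewrite -lead_coefE lead_coef_eq0.
pose n := (size p).-1.
have : \sum_(i < n.+1) p`_i * x^-1 ^+ (n - i) = 0.
  transitivity (x^-1 ^+ n * p.[x]); last by rewrite px mulr0.
  rewrite horner_coef prednK ?size_poly_gt0 // mulr_sumr.
  apply: eq_bigr => i _; have im : (i <= n)%N.
    by rewrite -ltnS prednK ?size_poly_gt0.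
  rewrite mulrCA -{2}(subnK im) exprD -mulrA -exprMn mulVf // expr1n mulr1 //.
rewrite big_ord_recr /= subnn expr0 mulr1 -lead_coefE => /eqP.
rewrite addrC addr_eq0 => /eqP lE.
suff Gs : G (- \sum_(i < n) p`_i * x^-1 ^+ (n - i), 0).
  by move: a0; rewrite (graph_fun pmG Ga (b := 0)) ?eqxx // lE.
rewrite -sub0r -[X in G (_, X)](subr0 0); apply: (graphB pmG); first exact: graph0.
have <- : \sum_(i < n) (0 : L) = 0 by rewrite big1.
apply: (graph_sum pmG) => i _.
have [->|pi0] := eqVneq p`_i 0; first by rewrite mul0r; exact: graph0.
have [b Gb _] := pu i pi0; rewrite -(mulr0 b); apply: graphM => //.
have -> : 0 = (0 : L) ^+ (n - i) by rewrite expr0n subn_eq0 leqNgt ltn_ord.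
exact: graphX.
Qed.

(** By [place_root_lead] x has an image. Were it 0, the relation would force the constant
    coefficient, a unit, to have image 0. *)
Lemma place_root_unit (p : {poly F}) x : p != 0 -> p.[x] = 0 -> x != 0 ->
  p`_0 != 0 -> (forall i, p`_i != 0 -> place_unit p`_i) -> place_unit x.
Proof.
have [pmG val] := plG.
move=> p0 px x0 p00 pu; have [a Gx] := place_root_lead p0 px pu.
have [a0|] := eqVneq a 0; last by exists a.
have [b Gb b0] := pu 0%N p00.
have pE : p.[x] = p`_0 + x * \sum_(i < (size p).-1) p`_i.+1 * x ^+ i.
  rewrite horner_coef -(@prednK (size p)) ?size_poly_gt0 // big_ord_recl /= expr0 mulr1.
  congr (_ + _); rewrite mulr_sumr; apply: eq_bigr => i _.
  by rewrite mulrCA -exprS.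
suff [c Gc] : exists c, G (\sum_(i < (size p).-1) p`_i.+1 * x ^+ i, c).
  have := graphD pmG Gb (graphM pmG Gx Gc).
  rewrite -pE px a0 mul0r addr0 => /(graph0P pmG) bE.
  by rewrite bE eqxx in b0.
elim/big_ind: _ => [|y z [c Gc] [d Gd]|i _]; first by exists 0; exact: graph0.
  by exists (c + d); exact: graphD.
have [->|pi0] := eqVneq p`_i.+1 0; first by exists 0; rewrite mul0r; exact: graph0.
have [d Gd _] := pu _ pi0; exists (d * a ^+ i).
by apply: graphM => //; exact: graphX.
Qed.

(** Over E the transcendental x may be sent to any w in L. Some w avoids the roots of the nonzero
    reductions of the finitely many polynomials in T, and the resulting morphism extends to a
    place. *)
Lemma place_adjoin_transcendental (E : F -> Prop) (x : F) (T : seq {poly F}) :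
  E 1 -> (forall y z, E y -> E z -> E (y - z)) ->
  (forall y z, E y -> E z -> E (y * z)) ->
  (forall p : {poly F}, (forall i, E p`_i) -> p.[x] = 0 -> p = 0) ->
  (forall p, p \in T -> p != 0 /\ forall i, E p`_i) ->
  (forall p, p \in T -> forall i, p`_i != 0 -> place_unit p`_i) ->
  exists2 G' : set (F * L), place G' &
    forall p, p \in T -> exists2 a, G' (p.[x], a) & a != 0.
Proof.
have [pmG val] := plG.
move=> E1 EB EM trx TE Tu.
(* The place is first restricted to E, because it may already prescribe an unsuitable value at x. *)
pose GE : set (F * L) := [set z | E z.1 /\ G z].
have pmGE : partial_morphism GE.
  split.
  - by split=> //; exact: graph1.
  - by move=> y z a b [Ey Gy] [Ez Gz]; split; [exact: EB | exact: graphB].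
  - by move=> y z a b [Ey Gy] [Ez Gz]; split; [exact: EM | exact: graphM].
  - by move=> a [_ /(graph0P pmG)].
have [Q [Q0 hQ]] : exists Q : {poly L}, Q != 0 /\ forall p, p \in T ->
    exists2 q, graph_poly GE p q & forall w, Q.[w] != 0 -> q.[w] != 0.
  elim: T TE Tu => [|p T IH] TE Tu; first by exists 1; rewrite oner_eq0.
  have [||Q [Q0 hQ]] := IH.
  - by move=> r rT; apply: TE; rewrite inE rT orbT.
  - by move=> r rT; apply: Tu; rewrite inE rT orbT.
  have [p0 pE] := TE _ (mem_head _ _).
  have ex_red i : exists b, GE (p`_i, b) /\ (p`_i != 0 -> b != 0).
    have [->|pi0] := eqVneq p`_i 0.
      by exists 0; rewrite !eqxx; split=> //; exact: (graph0 pmGE).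
    by have [a Ga a0] := Tu p (mem_head _ _) i pi0; exists a; split=> //; split=> //; exact: pE.
  have [f fP] := boolp.choice ex_red.
  pose q := \poly_(i < size p) f i.
  have Gq : graph_poly GE p q.
    move=> i; rewrite coef_poly; case: ltnP => [_|le]; first by case: (fP i).
    by rewrite nth_default //; exact: graph0.
  have q0 : q != 0.
    apply/eqP => /(congr1 (fun q : {poly L} => q`_(size p).-1)).
    rewrite coef0 coef_poly prednK ?size_poly_gt0 // leqnn => /eqP; apply/negP.
    by case: (fP (size p).-1) => _; apply; rewrite -lead_coefE lead_coef_eq0.
  exists (q * Q); split; first by rewrite mulf_neq0.
  move=> r; rewrite inE => /orP[/eqP ->|rT].
    by exists q => // w; rewrite hornerM mulf_eq0 negb_or => /andP[].
  have [q' Gq' hq'] := hQ r rT; exists q' => // w.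
  by rewrite hornerM mulf_eq0 negb_or => /andP[_ /hq'].
have [w Qw] : exists w, ~~ root Q w by exact/closed_nonrootP.
have pmA : partial_morphism (adjoin_graph GE x w).
  apply: adjoin_graph_morphism => // p q Gpq px.
  have p0 : p = 0 by apply: trx => // i; case: (Gpq i).
  suff -> : q = 0 by rewrite horner0.
  apply/polyP => i; rewrite coef0; have := Gpq i; rewrite p0 coef0.
  exact: graph0P.
have [G' AG' plG'] := place_extension pmA.
exists G' => // p pT; have [q Gq hq] := hQ p pT.
exists q.[w]; last exact: hq.
by apply: AG'; exists p, q.
Qed.

End PlaceTheory.

(** Being algebraic over F_p is phrased as being fixed by an iterate of Frobenius, that is, lying in
    a finite subfield; this is the form used to apply Wedderburn's theorem. *)
Definition algebraic_over_Fp (p : nat) (k : fieldType) : Prop :=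
  p \in [pchar k] /\ forall w : k, exists2 m, (0 < m)%N & w ^+ (p ^ m) = w.

(** The powers w^(p^i) all lie in the finite F_p-span of finitely many powers of w, so two of them
    coincide; injectivity of Frobenius cancels the smaller exponent. *)
Lemma prime_field_closure p : prime p ->
  exists L : closedFieldType, algebraic_over_Fp p L.
Proof.
move=> p_pr; have [L [f fP]] := countable_algebraic_closure 'F_p.
exists L; have pL : p \in [pchar L] by apply/(rmorph_pchar f)/pchar_Fp.
split=> // w; have [P Pmon Pw] := fP w.
have P0 : P != 0 by rewrite monic_neq0.
pose ev (c : 'rV['F_p]_(size P)) := (map_poly f (rVpoly c)).[w].
have wn n : exists c, ev c = w ^+ n.
  exists (poly_rV ('X^n %% P)); rewrite /ev poly_rV_K; last first.
    by rewrite ltnW // ltn_modp.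
  transitivity ((map_poly f 'X^n).[w]); last by rewrite map_polyXn hornerXn.
  rewrite {2}(divp_eq 'X^n P) rmorphD rmorphM !hornerE.
  by rewrite (rootP Pw) mulr0 add0r.
have [c cP] := boolp.choice (fun i => wn (p ^ i)%N).
pose N := #|{: 'rV['F_p]_(size P)}|.
have /injectivePn[i [j]] : ~~ injectiveb (fun i : 'I_N.+1 => c i).
  apply/injectiveP => /leq_card; by rewrite card_ord ltnn.
wlog ij : i j / (i < j)%N => [wl ij cij|_ cij].
  have [lt|gt|eq] := ltngtP i j; first by apply: (wl i j).
    by apply: (wl j i) => //; rewrite eq_sym.
  by move/val_inj: eq ij => ->; rewrite eqxx.
exists (j - i)%N; first by rewrite subn_gt0.
have pnat : [pchar L].-nat (p ^ i)%N by rewrite pnatX pnatE // pL.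
have : (w ^+ (p ^ (j - i)) - w) ^+ (p ^ i) = 0.
  rewrite exprDn_pchar // exprNn_pchar // -exprM -expnD subnK ?(ltnW ij) //.
  by rewrite -!cP cij subrr.
by move/eqP; rewrite expf_eq0 subr_eq0 => /andP[_ /eqP].
Qed.

(** * Places at which finitely many given elements are units *)

Section ManyUnits.
Variable F : fieldType.
Implicit Types (E : F -> Prop) (S T : seq F).

Definition units_at_place S : Prop :=
  exists (p : nat) (L : closedFieldType) (G : set (F * L)),
    [/\ algebraic_over_Fp p L, place G & forall x, x \in S -> place_unit G x].

(** Allowing every finite list [T] of E lets an induction on [S] enlarge E to E[x]: a demand on
    elements of E[x] turns into one on their coefficients in E. *)
Definition has_places E S : Prop :=
  forall T, (forall t, t \in T -> E t /\ t != 0) -> units_at_place (S ++ T).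

Lemma has_places_int : has_places (fun x => exists z : int, x = z%:~R) [::].
Proof.
move=> T TE.
have [p [p_pr pz pT]] : exists p : nat, [/\ prime p,
    forall z : int, z%:~R = 0 :> F -> (p %| `|z|)%N &
    forall t, t \in T -> exists2 z : int, t = z%:~R & ~~ (p %| `|z|)%N].
  have [[p pF]|noc] := pselect (exists p, p \in [pchar F]).
    have zE (z : int) : (z%:~R == 0 :> F) = (p %| `|z|)%N.
      case: (intP z) => [|n|n]; rewrite ?mulr0z ?eqxx ?dvdn0 //.
        by rewrite -pmulrn absz_nat (dvdn_pcharf pF).
      by rewrite mulrNz oppr_eq0 abszN -pmulrn absz_nat (dvdn_pcharf pF).
    exists p; split; first exact: pcharf_prime pF.
      by move=> z /eqP; rewrite zE.
    by move=> t /TE[[z ->] z0]; exists z; rewrite // -zE.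
  have pF0 : [pchar F] =i pred0 by move=> p; apply/negP => pF; apply: noc; exists p.
  have /pcharf0P n0E := pF0.
  have zE (z : int) : (z%:~R == 0 :> F) = (z == 0).
    case: (intP z) => [|n|n]; rewrite ?mulr0z ?eqxx //.
      by rewrite -pmulrn n0E.
    by rewrite mulrNz oppr_eq0 -pmulrn n0E oppr_eq0.
  have [n nT] : exists n : nat, forall t, t \in T ->
      exists2 z : int, t = z%:~R & (0 < `|z| <= n)%N.
    elim: T TE => [|t T IH] TE; first by exists 0%N.
    have [|n nT] := IH; first by move=> u uT; apply: TE; rewrite inE uT orbT.
    have [[z tz] t0] := TE t (mem_head _ _).
    exists (maxn n `|z|); move=> u; rewrite inE => /orP[/eqP ->|/nT[y uy /andP[y0 yn]]].
      exists z; rewrite // leq_maxr andbT absz_gt0 -zE -tz //.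
    by exists y; rewrite // y0 leq_max yn.
  (* A prime divisor of n! + 1 exceeds n, so it divides none of the integers in [T]. *)
  have : prime (pdiv n`!.+1) by apply: pdiv_prime; rewrite ltnS fact_gt0.
  move: (pdiv_dvd n`!.+1); move: (pdiv _) => p p_dvd p_pr.
  exists p; split=> // [z /eqP|t /nT[z tz /andP[z0 zn]]].
    by rewrite zE => /eqP ->; rewrite dvdn0.
  exists z => //; apply/negP => /(dvdn_leq z0) le.
  have p_fact : (p %| n`!)%N by rewrite dvdn_fact // prime_gt0 //= (leq_trans le).
  by move: p_dvd; rewrite -addn1 dvdn_addr // dvdn1 => /eqP p1; rewrite p1 in p_pr.
have [L [pL algL]] := prime_field_closure p_pr.
have zE (z : int) : (z%:~R == 0 :> L) = (p %| `|z|)%N.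
  case: (intP z) => [|n|n]; rewrite ?mulr0z ?eqxx ?dvdn0 //.
    by rewrite -pmulrn absz_nat (dvdn_pcharf pL).
  by rewrite mulrNz oppr_eq0 abszN -pmulrn absz_nat (dvdn_pcharf pL).
pose G0 : set (F * L) := [set u | exists z : int, u = (z%:~R, z%:~R)].
have pmG : partial_morphism G0.
  split.
  - by exists 1.
  - move=> _ _ _ _ [y [-> ->]] [z [-> ->]]; exists (y - z).
    by rewrite !rmorphB.
  - move=> _ _ _ _ [y [-> ->]] [z [-> ->]]; exists (y * z).
    by rewrite !rmorphM.
  - by move=> a [z [/esym/pz pz0 ->]]; apply/eqP; rewrite zE.
have [G GG plG] := place_extension pmG.
exists p, L, G; split=> // t /pT[z -> pz0]; exists z%:~R; last by rewrite zE.
by apply: GG; exists z.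
Qed.

(** If x is algebraic over E, it becomes a unit once the nonzero coefficients of a relation with
    nonzero constant term are units. If x is transcendental, E is replaced by E[x]. Either way only
    finitely many further units in E are requested. *)
Lemma has_places_adjoin E S : E 1 -> (forall y z, E y -> E z -> E (y - z)) ->
  (forall y z, E y -> E z -> E (y * z)) ->
  has_places E [::] -> 0 \notin S -> has_places E S.
Proof.
elim: S E => [//|x S IH] E E1 EB EM hE.
rewrite inE negb_or eq_sym => /andP[x0 S0] T TE.
have E0 : E 0 by rewrite -(subrr 1); exact: EB.
have ED y z : E y -> E z -> E (y + z).
  by move=> Ey Ez; rewrite -[z]opprK -[- z]sub0r; apply: (EB) => //; exact: EB.
have Esum (I : Type) (r : seq I) (f : I -> F) :
    (forall i, E (f i)) -> E (\sum_(i <- r) f i).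
  by move=> Ef; elim/big_ind: _.
have [[p [pE p0 px]]|trx] := pselect (exists p : {poly F},
    [/\ forall i, E p`_i, p != 0 & p.[x] = 0]).
  (* Dividing by X while the constant term vanishes keeps the root x, since x is not 0. *)
  have {p pE p0 px} [p [pE p0 px p00]] : exists p : {poly F},
      [/\ forall i, E p`_i, p != 0, p.[x] = 0 & p`_0 != 0].
    elim: {p}(size p) {-2}p (leqnn (size p)) pE p0 px => [|n IHn] p sp pE p0 px.
      by move: sp; rewrite leqn0 size_poly_eq0 (negPf p0).
    have [p00|] := eqVneq p`_0 0; last by exists p.
    have pX : p = (p %/ 'X) * 'X.
      by rewrite divpK // -['X]subr0 -polyC0 dvdp_XsubCl rootE horner_coef0 p00.
    have cE i : (p %/ 'X)`_i = p`_i.+1 by rewrite {2}pX coefMX.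
    have q0 : p %/ 'X != 0 by apply: contraNneq p0 => q0; rewrite pX q0 mul0r.
    apply: (IHn (p %/ 'X)) => //.
    - by move: sp; rewrite {1}pX size_mulX.
    - by move=> i; rewrite cE.
    - apply/eqP; move/eqP: px; rewrite {1}pX hornerMX mulf_eq0 (negPf x0).
      by rewrite orbF.
  have [|q [L [G [aL plG uG]]]] := IH E E1 EB EM hE S0 ([seq c <- p : seq F | c != 0] ++ T).
    move=> t; rewrite mem_cat => /orP[|/TE //].
    by rewrite mem_filter => /andP[t0 /(nthP 0)[i _ it]]; split=> //; rewrite -it.
  exists q, L, G; split=> // t; rewrite /= inE => /orP[/eqP ->|tST]; last first.
    apply: uG; move: tST; rewrite !mem_cat => /orP[->//|->]; by rewrite !orbT.
  apply: (place_root_unit plG p0 px) => // i pi0; apply: uG.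
  rewrite !mem_cat mem_filter pi0 /= mem_nth ?orbT //.
  by rewrite ltnNge; apply: contra pi0 => le; rewrite nth_default.
pose E' y := exists2 p : {poly F}, (forall i, E p`_i) & y = p.[x].
have Ep (t : F) : E t -> forall i, E (t%:P)`_i.
  by move=> Et i; rewrite coefC; case: ifP.
have EX i : E ('X : {poly F})`_i by rewrite coefX; case: eqP.
have hE' : has_places E' [::].
  move=> U UE.
  have [V [VE UV]] : exists V : seq {poly F}, (forall p, p \in V -> p != 0 /\ forall i, E p`_i)
      /\ forall u, u \in U -> exists2 p, p \in V & u = p.[x].
    elim: U UE => [|u U IHU] UE; first by exists [::].
    have [|V [VE UV]] := IHU; first by move=> v vU; apply: UE; rewrite inE vU orbT.
    have [[p pE up] u0] := UE u (mem_head _ _).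
    exists (p :: V); split=> v; rewrite inE => /orP[/eqP ->|vV].
    - by split=> //; apply: contraNneq u0 => p0; rewrite up p0 horner0.
    - exact: VE.
    - by exists p; rewrite ?mem_head.
    - by have [q qV ->] := UV v vV; exists q; rewrite // inE qV orbT.
  have [|q [L [G [aL plG uG]]]] :=
      hE (flatten [seq [seq c <- p : seq F | c != 0] | p : {poly F} <- V]).
    move=> t /flatten_mapP[p pV]; rewrite mem_filter => /andP[t0 /(nthP 0)[i _ it]].
    by split=> //; rewrite -it; case: (VE p pV).
  have [||G' plG' uG'] := place_adjoin_transcendental plG E1 EB EM (x := x) _ VE _.
  - by move=> p pE px; apply/eqP; apply: contrapT => /negP p0; apply: trx; exists p.
  - move=> p pV i pi0; apply: uG; apply/flatten_mapP; exists p => //.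
    rewrite mem_filter pi0 mem_nth //.
    by rewrite ltnNge; apply: contra pi0 => le; rewrite nth_default.
  - exists q, L, G'; split=> // u /UV[p pV ->]; exact: uG'.
have := IH E' _ _ _ hE' S0 (x :: T); case.
- by exists 1%:P; rewrite ?hornerC //; exact: Ep.
- move=> _ _ [p pE ->] [q qE ->]; exists (p - q); rewrite ?hornerE // => i.
  by rewrite coefB; exact: EB.
- move=> _ _ [p pE ->] [q qE ->]; exists (p * q); rewrite ?hornerE // => i.
  by rewrite coefM; apply: Esum => j; exact: EM.
- move=> t; rewrite inE => /orP[/eqP ->|/TE[Et t0]]; split=> //.
    by exists 'X; rewrite ?hornerX.
  by exists t%:P; rewrite ?hornerC //; exact: Ep.
move=> p [L [G [aL plG uG]]]; exists p, L, G; split=> // t.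
by move=> tS; apply: uG; move: tS; rewrite /= !(inE, mem_cat) orbCA.
Qed.

End ManyUnits.

(** * Valuation rings and residue maps *)

Record residue_map (F k : fieldType) (O : F -> Prop) (h : F -> k) : Prop :=
  ResidueMap {
    res_in1 : O 1;
    res_inB : forall x y, O x -> O y -> O (x - y);
    res_inM : forall x y, O x -> O y -> O (x * y);
    res_total : forall x, O x \/ (O x^-1 /\ h x^-1 = 0);
    res1 : h 1 = 1;
    resB : forall x y, O x -> O y -> h (x - y) = h x - h y;
    resM : forall x y, O x -> O y -> h (x * y) = h x * h y;
    res_onto : forall a, exists2 x, O x & h x = a }.

Section ResidueField.
Variables (F : fieldType) (L : closedFieldType) (G : set (F * L)).
Hypothesis plG : place G.

(** The image of the place, a subfield of L. It replaces L because elements of the residue field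
    must lift to the valuation ring. *)
Definition residue_values : {pred L} := fun a => `[< exists x, G (x, a) >].

Let residue_values_divring : divring_closed residue_values.
Proof.
have [pmG _] := plG.
split; first by apply/asboolP; exists 1; exact: graph1.
  move=> a b /asboolP[x Gx] /asboolP[y Gy]; apply/asboolP; exists (x - y).
  exact: graphB.
move=> a b /asboolP[x Gx] /asboolP[y Gy]; apply/asboolP.
have [->|b0] := eqVneq b 0; first by exists 0; rewrite invr0 mulr0; exact: graph0.
by exists (x * y^-1); apply: (graphM pmG) => //; exact: place_inv.
Qed.

HB.instance Definition _ :=
  GRing.isDivringClosed.Build L residue_values residue_values_divring.

(* The proof argument is needed by the field structure below. *)
Definition residue_field of place G := {a : L | residue_values a}.
Local Notation k := (residue_field plG).
HB.instance Definition _ := SubChoice.on k.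
HB.instance Definition _ := [SubChoice_isSubComUnitRing of k by <:].
HB.instance Definition _ := [SubComUnitRing_isSubIntegralDomain of k by <:].
HB.instance Definition _ := [SubIntegralDomain_isSubField of k by <:].

Lemma place_residue_map : exists h : F -> k,
  residue_map (fun x => exists a, G (x, a)) h /\
  forall x a, G (x, a) -> val (h x) = a.
Proof.
have [pmG valG] := plG.
have ex_h x : exists b : k, forall a, G (x, a) -> val b = a.
  have [[a Ga]|na] := pselect (exists a, G (x, a)); last first.
    by exists 0 => a Ga; case: na; exists a.
  have ra : residue_values a by apply/asboolP; exists x.
  by exists (exist _ a ra : k) => b Gb /=; exact: (graph_fun pmG Ga).
have [h hP] := boolp.choice ex_h.
exists h; split=> //; split.
- by exists 1; exact: graph1.
- by move=> x y [a Ga] [b Gb]; exists (a - b); exact: graphB.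
- by move=> x y [a Ga] [b Gb]; exists (a * b); exact: graphM.
- move=> x; have [|Gx] := valG x; [by left | right].
  by split; [exists 0 | apply/val_inj; rewrite (hP _ _ Gx)].
- by apply/val_inj; rewrite (hP _ _ (graph1 pmG)).
- move=> x y [a Ga] [b Gb]; apply/val_inj; rewrite (hP _ _ (graphB pmG Ga Gb)).
  by rewrite rmorphB /= (hP _ _ Ga) (hP _ _ Gb).
- move=> x y [a Ga] [b Gb]; apply/val_inj; rewrite (hP _ _ (graphM pmG Ga Gb)).
  by rewrite rmorphM /= (hP _ _ Ga) (hP _ _ Gb).
- move=> a; have /asboolP[x Gx] := valP a; exists x; first by exists (val a).
  by apply/val_inj; rewrite (hP _ _ Gx).
Qed.

End ResidueField.

Theorem exists_residue_map (F : fieldType) (S : seq F) : 0 \notin S ->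
  exists (p : nat) (k : fieldType) (O : F -> Prop) (h : F -> k),
    [/\ algebraic_over_Fp p k, residue_map O h &
        forall x, x \in S -> O x /\ h x != 0].
Proof.
move=> S0.
have [p [L [G [[pL aL] plG uG]]]] : units_at_place (S ++ [::]).
  apply: (has_places_adjoin _ _ _ (@has_places_int F) S0) => //.
  - by exists 1.
  - by move=> _ _ [y ->] [z ->]; exists (y - z); rewrite rmorphB.
  - by move=> _ _ [y ->] [z ->]; exists (y * z); rewrite rmorphM.
have [h [hres hG]] := place_residue_map plG.
exists p, (residue_field plG), (fun x => exists a, G (x, a)), h; split=> //.
  split.
    apply/andP; split; first exact: pcharf_prime pL.
    by apply/eqP/val_inj; rewrite rmorph_nat /= (pcharf0 pL).
  move=> w; have [m m0 wm] := aL (val w); exists m => //.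
  by apply/val_inj; rewrite rmorphXn.
move=> x xS; have [a Ga a0] : place_unit G x by apply: uG; rewrite cats0.
split; first by exists a.
by apply: contraNneq a0 => hx; rewrite -(hG _ _ Ga) hx rmorph0.
Qed.

(** * Primitive idempotents of prime rings *)

Definition prime_ring (R : nzRingType) : Prop :=
  forall y z : R, (forall w, y * w * z = 0) -> y = 0 \/ z = 0.

(** That is, yR is a minimal right ideal: every nonzero y z in it generates y back. *)
Definition minimal_right (R : nzRingType) (y : R) : Prop :=
  y != 0 /\ forall z, y * z != 0 -> exists w, y * z * w = y.

Definition primitive_idem (R : nzRingType) (e : R) : Prop :=
  e * e = e /\ minimal_right e.

Section PrimeRing.
Variable R : nzRingType.
Hypothesis primeR : prime_ring R.
Implicit Types a e f r s w x y z : R.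

Lemma prime_neq0 y z : y != 0 -> z != 0 -> exists w, y * w * z != 0.
Proof.
move=> y0 z0; apply: contrapT => no_w.
have [|yE|zE] := primeR (y := y) (z := z).
- by move=> w; apply/eqP; apply: contrapT => /negP yz; apply: no_w; exists w.
- by rewrite yE eqxx in y0.
- by rewrite zE eqxx in z0.
Qed.

(* Brauer's lemma, inside the right ideal f R *)
Lemma primitive_idem_exists f : f * f = f ->
  (exists z, minimal_right (f * z)) ->
  exists e, [/\ primitive_idem e, f * e = e & e * f = e].
Proof.
move=> ff [z0 []]; set y := f * z0 => y0 miny.
have fy : f * y = y by rewrite /y mulrA ff.
have [w ywy0] := prime_neq0 y0 y0.
have [v yv] : exists v, y * w * y * v = y * w.
  have [|v yv] := miny (w * y); first by rewrite mulrA.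
  by exists (v * w); rewrite !mulrA in yv *; rewrite yv.
pose e := y * v.
have ywe : y * w * e = y * w by rewrite /e mulrA.
have ee : e * e = e.
  (* ee - e lies in yR and is killed by y w from the left. If it were nonzero, it would generate y,
     and y w y would vanish. *)
  apply/eqP; rewrite -subr_eq0; apply/negPn/negP => ne.
  have de : e * e - e = y * (v * y * v - v) by rewrite /e mulrBr !mulrA.
  have [|u yu] := miny (v * y * v - v); first by rewrite -de.
  move: ywy0; rewrite -[X in _ * X]yu -de mulrA mulrBr mulrA !ywe subrr.
  by rewrite mul0r eqxx.
have e0 : e != 0.
  apply: contraNneq ywy0 => e0.
  by rewrite -ywe e0 mulr0 mul0r.
have fe : f * e = e by rewrite /e mulrA fy.
have efe : e * f * e = e by rewrite -mulrA fe.
(* [e] lies in fR but perhaps not in Rf; multiplying by f on the right moves it into fRf and keeps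
   it idempotent because f e = e. *)
exists (e * f); split; last 2 first.
- by rewrite mulrA fe.
- by rewrite -mulrA ff.
split; first by rewrite mulrA efe.
split; first by apply: contraNneq e0 => ef0; rewrite -efe ef0 mul0r.
move=> z nz; have [|u yu] := miny (v * f * z).
  by apply: contraNneq nz => h; rewrite -h /e !mulrA.
by exists (u * v * f); rewrite /e -[in RHS]yu !mulrA.
Qed.

(** Schur's lemma: the corner eRe is a division ring. Minimality gives right inverses, and the right
    inverse of a right inverse of x is x itself. *)
Lemma primitive_corner_inv e x : primitive_idem e -> x != 0 -> e * x = x ->
  x * e = x -> exists y, [/\ e * y = y, y * e = y, x * y = e & y * x = e].
Proof.
move=> [ee [e0 mine]].
have rinv z : z != 0 -> e * z = z -> z * e = z ->
    exists y, [/\ y != 0, e * y = y, y * e = y & z * y = e].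
  move=> z0 ez ze; have [|w zw] := mine z; first by rewrite ez.
  exists (e * w * e); rewrite !mulrA ee; split=> //.
  - apply: contraNneq e0 => ewe; rewrite -ee -{1}zw ez -{1}ze -2!mulrA.
    by rewrite [e * (w * e)]mulrA ewe mulr0.
  - by rewrite -mulrA ee.
  - by rewrite ze -{1}ez zw ee.
move=> x0 ex xe; have [y [y0 ey ye xy]] := rinv x x0 ex xe.
have [z [_ ez ze yz]] := rinv y y0 ey ye.
have zx : z = x by rewrite -ez -xy -mulrA yz xe.
by exists y; split=> //; rewrite -zx.
Qed.

(** Primeness gives w with e w y nonzero, hence invertible in eRe; so y z = 0 would force z = e z =
    0. *)
Lemma primitive_mul_neq0 e y z : primitive_idem e -> y != 0 -> z != 0 ->
  y * e = y -> e * z = z -> y * z != 0.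
Proof.
move=> pe y0 z0 ye ez; have [ee [e0 _]] := pe.
have [w ewy] := prime_neq0 e0 y0.
have [| |u [_ _ _ uE]] := primitive_corner_inv pe ewy.
- by rewrite !mulrA ee.
- by rewrite -mulrA ye.
apply: contraNneq z0 => yz.
by rewrite -ez -uE -!mulrA yz !mulr0.
Qed.

Lemma primitive_conj e u v : u * v = 1 -> v * u = 1 ->
  primitive_idem e -> primitive_idem (u * e * v).
Proof.
move=> uv vu [ee [e0 mine]]; split.
  by rewrite !mulrA -(mulrA (u * e) v u) vu mulr1 -(mulrA u e e) ee.
split.
  apply: contraNneq e0 => h.
  have -> : e = v * (u * e * v) * u by rewrite !mulrA vu mul1r -mulrA vu mulr1.
  by rewrite h mulr0 mul0r.
move=> z nz; have [|w ew] := mine (v * z).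
  by apply: contraNneq nz => h; rewrite -!mulrA h mulr0.
by exists (w * v); rewrite -!mulrA; congr (u * _); rewrite !mulrA in ew *; rewrite ew.
Qed.

(** The idempotent is y (w y)^-1 w, the inverse taken in eRe, where w in eR(1 - e) kills neither y
    nor z. If w1 is nonzero only on y and w2 only on z, then w1 + w2 serves as w. *)
Lemma primitive_orthogonal_exists e y z : primitive_idem e ->
  y != 0 -> z != 0 -> e * y = 0 -> e * z = 0 -> y * e = y -> z * e = z ->
  exists e', [/\ primitive_idem e', e * e' = 0, e' * e = 0, e' * y != 0 & e' * z != 0].
Proof.
move=> pe y0 z0 ey ez ye ze; have [ee [e0 mine]] := pe.
have func x : x != 0 -> e * x = 0 ->
    exists w, [/\ e * w = w, w * e = 0 & w * x != 0].
  move=> x0 ex; have [w ewx] := prime_neq0 e0 x0.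
  exists (e * w * (1 - e)); rewrite !mulrA ee; split=> //.
    by rewrite -mulrA mulrBl mul1r ee subrr mulr0.
  by rewrite -mulrA mulrBl mul1r ex subr0.
have [w [ew we wy wz]] : exists w, [/\ e * w = w, w * e = 0, w * y != 0 & w * z != 0].
  have [w1 [ew1 w1e w1y]] := func y y0 ey; have [w2 [ew2 w2e w2z]] := func z z0 ez.
  have [w1z|] := eqVneq (w1 * z) 0; last by exists w1.
  have [w2y|] := eqVneq (w2 * y) 0; last by exists w2.
  by exists (w1 + w2); rewrite mulrDr !mulrDl ew1 ew2 w1e w2e w1z w2y !(addr0, add0r).
have [| |v [ev ve uv vu]] := primitive_corner_inv pe wy.
- by rewrite mulrA ew.
- by rewrite -mulrA ye.
have vwz : v * (w * z) != 0.
  apply: contraNneq wz => h.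
  by rewrite -ew -mulrA -uv -!mulrA h !mulr0.
exists (y * v * w); split.
- split.
    by rewrite !mulrA -(mulrA (y * v) w y) -(mulrA y v (w * y)) vu ye.
  split.
    apply: contraNneq y0 => h.
    by rewrite -ye -vu !mulrA h mul0r.
  move=> x nx; have [|t et] := mine (v * w * x).
    rewrite !mulrA ev; apply: contraNneq nx => h.
    by rewrite -!mulrA in h *; rewrite h mulr0.
  exists (t * v * w); rewrite !mulrA ev in et.
  have -> : y * v * w * x * (t * v * w) = y * (v * w * x * t) * (v * w).
    by rewrite !mulrA.
  by rewrite et ye mulrA.
- by rewrite !mulrA ey !mul0r.
- by rewrite -mulrA we mulr0.
- by rewrite -!mulrA vu ye.
- rewrite -!mulrA; apply: (primitive_mul_neq0 pe) => //.
  by rewrite mulrA ev.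
Qed.

(* [a, -] is a derivation; it kills the corner (1 - e) R e, hence by primeness
   everything. *)
Lemma central_of_corner a e : e != 0 -> 1 - e != 0 -> e * e = e -> a * e = e * a ->
  (forall r, e * r = 0 -> r * e = r -> a * r = r * a) -> forall s, a * s = s * a.
Proof.
move=> e0; set f := 1 - e => f0 ee ae corner s.
pose C x := a * x - x * a.
have CM x y : C (x * y) = C x * y + x * C y.
  by rewrite /C mulrBl mulrBr !mulrA addrA subrK.
have CD x y : C (x + y) = C x + C y by rewrite /C mulrDr mulrDl opprD addrACA.
have Ce : C e = 0 by rewrite /C ae subrr.
have Cf : C f = 0 by rewrite /C mulrBr mulrBl mulr1 mul1r ae subrr.
have ff : f * f = f by rewrite mulrBr mulr1 mulrBl mul1r ee subrr subr0.
have ef : e * f = 0 by rewrite mulrBr mulr1 ee subrr.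
have fe : f * e = 0 by rewrite mulrBl mul1r ee subrr.
have Cfe w : C (f * w * e) = 0.
  have fwe : a * (f * w * e) = f * w * e * a.
    apply: corner; first by rewrite !mulrA ef !mul0r.
    by rewrite -(mulrA _ e e) ee.
  by rewrite /C fwe subrr.
have Cff x : C (f * x * f) = 0.
  set y := f * x * f.
  have yf : y * f = y by rewrite /y -(mulrA _ f f) ff.
  have Cyf : C y * f = C y by have := CM y f; rewrite yf Cf mulr0 addr0.
  have [w|//|h] := primeR (y := C y) (z := e); last by rewrite h eqxx in e0.
  have := Cfe (x * f * w).
  have -> : f * (x * f * w) * e = y * (f * w * e).
    by rewrite /y !mulrA -(mulrA (f * x) f f) ff.
  by rewrite CM Cfe mulr0 addr0 !mulrA Cyf.
(* Since C kills f w e and f w x = (f w e) x, the hypothesis gives f w C(x) = 0 for all w, and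
   primeness applies. *)
have Cel x : f * x = 0 -> (forall w, C (f * w * x) = 0) -> C x = 0.
  move=> fx Cx; have ex : e * x = x.
    by apply/eqP; rewrite eq_sym -subr_eq0 -{1}[x]mul1r -mulrBl fx.
  have eCx : e * C x = C x by have := CM e x; rewrite ex Ce mul0r add0r.
  have [w|h|//] := primeR (y := f) (z := C x); last by rewrite h eqxx in f0.
  have := Cx w; rewrite -[in f * w * x]ex mulrA CM Cfe mul0r add0r.
  by rewrite -(mulrA _ e) eCx.
have Cef x : C (e * x * f) = 0.
  apply: Cel => [|w]; first by rewrite !mulrA fe !mul0r.
  by have := Cff (w * e * x); rewrite !mulrA.
have Cee x : C (e * x * e) = 0.
  apply: Cel => [|w]; first by rewrite !mulrA fe !mul0r.
  by have := Cfe (w * e * x); rewrite !mulrA.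
have sE : s = e * s * e + e * s * f + (f * s * e + f * s * f).
  have ef1 : e + f = 1 by rewrite /f addrC subrK.
  by rewrite -!mulrDr ef1 !mulr1 -mulrDl ef1 mul1r.
by apply/eqP; rewrite -subr_eq0 -/(C s) sE !CD Cee Cef Cfe Cff !addr0.
Qed.

End PrimeRing.

(** * Primitive idempotents in general position *)

Lemma size_filter_few (T : eqType) (P : pred T) (s : seq T) : uniq s ->
  (forall x y z, P x -> P y -> P z -> [|| x == y, y == z | x == z]) ->
  (size s <= size [seq t <- s | ~~ P t] + 2)%N.
Proof.
move=> us P3; rewrite -(count_predC P s) addnC size_filter leq_add2l -size_filter.
case E : [seq t <- s | P t] (filter_uniq P us) => [|x [|y [|z l]]] //= ul.
have Pm u : u \in [:: x, y, z & l] -> P u by rewrite -E mem_filter => /andP[].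
have := P3 x y z; rewrite !Pm ?inE ?eqxx ?orbT // => /(_ isT isT isT).
by move: ul; rewrite !inE; do 3! [case: eqP => //= _]; rewrite ?andbF.
Qed.

(** The coefficients are vectors, so divided differences replace the count of polynomial roots:
    three distinct zeros give C = 0, then B = 0, then A = 0. *)
Lemma quadratic_few_roots (k : fieldType) (V : lmodType k) (A B C : V) :
  [|| A != 0, B != 0 | C != 0] ->
  forall x y z, A + x *: B + x ^+ 2 *: C == 0 -> A + y *: B + y ^+ 2 *: C == 0 ->
  A + z *: B + z ^+ 2 *: C == 0 -> [|| x == y, y == z | x == z].
Proof.
move=> BC x y z /eqP hx /eqP hy /eqP hz; apply: contraT; rewrite !negb_or.
case/and3P => xy yz xz; exfalso.
have lin u v : u != v -> A + u *: B + u ^+ 2 *: C = 0 ->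
    A + v *: B + v ^+ 2 *: C = 0 -> B + (u + v) *: C = 0.
  move=> uv hu hv; apply: (@scalerI _ _ (u - v)); first by rewrite subr_eq0.
  rewrite scaler0; transitivity (A + u *: B + u ^+ 2 *: C - (A + v *: B + v ^+ 2 *: C)).
    rewrite scalerDr scalerA -subr_sqr !scalerBl !opprD [RHS]addrACA.
    by rewrite (addrACA A) subrr add0r.
  by rewrite hu hv subrr.
have h1 := lin x y xy hx hy; have h2 := lin x z xz hx hz.
have C0 : C = 0.
  apply: (@scalerI _ _ (y - z)); first by rewrite subr_eq0.
  rewrite scaler0; transitivity (B + (x + y) *: C - (B + (x + z) *: C)).
    by rewrite opprD addrACA subrr add0r -scalerBl opprD addrACA subrr add0r.
  by rewrite h1 h2 subrr.
move: h1; rewrite C0 scaler0 addr0 => B0.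
by move: hx BC; rewrite B0 C0 !scaler0 !addr0 => ->; rewrite eqxx.
Qed.

Lemma quadratic_avoid_roots (k : fieldType) (V : lmodType k) (s : seq k)
    (l : seq (V * V * V)) : uniq s -> (size l * 2 < size s)%N ->
  (forall q, q \in l -> [|| q.1.1 != 0, q.1.2 != 0 | q.2 != 0]) ->
  exists2 t, t \in s & forall q, q \in l -> q.1.1 + t *: q.1.2 + t ^+ 2 *: q.2 != 0.
Proof.
elim: l s => [|q l IH] s us ss hl.
  by case: s ss {us} => // t s _; exists t; rewrite ?mem_head.
pose P t := q.1.1 + t *: q.1.2 + t ^+ 2 *: q.2 == 0.
have few := size_filter_few us (quadratic_few_roots (hl q (mem_head _ _))).
have [||r rl|t] := IH [seq t <- s | ~~ P t].
- exact: filter_uniq.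
- by rewrite -(ltn_add2r 2) (leq_trans _ few) // addnC -mulSn.
- by apply: hl; rewrite inE rl orbT.
rewrite mem_filter => /andP[Pt ts] tl; exists t => // r.
by rewrite inE => /orP[/eqP ->|/tl].
Qed.

Section GenericPosition.
Variables (k : fieldType) (R : algType k).
Hypothesis primeR : prime_ring R.
Implicit Types a e f r s w x y z : R.

(** Otherwise a e' = e' a e' for every primitive e'. This holds in particular for e + t r, a
    conjugate of e by 1 + t r, with r in (1 - e)Re. Comparing t = 1 with t = t0 separates the powers
    of t, whence a commutes with e and with every r, and [central_of_corner] makes a central. *)
Lemma primitive_moved_exists e a (t0 : k) : primitive_idem e -> e != 1 ->
  t0 != 0 -> t0 != 1 -> ~ (forall s, a * s = s * a) ->
  exists2 e', primitive_idem e' & (1 - e') * a * e' != 0.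
Proof.
move=> pe e1 t00 t01 nca; apply: contrapT => no_e'; apply: nca.
have stable e' : primitive_idem e' -> a * e' = e' * a * e'.
  move=> pe'; apply/eqP; rewrite -subr_eq0 -mulrA -{1}[a * e']mul1r -mulrBl mulrA.
  by apply: contrapT => /negP h; apply: no_e'; exists e'.
have [ee [e0 _]] := pe.
have ae := stable e pe.
have f0 : 1 - e != 0 by rewrite subr_eq0 eq_sym.
have shear r : e * r = 0 -> r * e = r -> a * r = e * a * r + r * a * e /\ r * a * r = 0.
  move=> er re.
  have rr : r * r = 0 by rewrite -{1}re -mulrA er mulr0.
  pose X := a * r - (e * a * r + r * a * e).
  have Xt t : t != 0 -> X = t *: (r * a * r).
    move=> tn0; pose u := 1 + t *: r; pose v := 1 - t *: r.
    have uv : u * v = 1.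
      by rewrite mulrBr mulr1 mulrDl mul1r -scalerAl -scalerAr rr !scaler0 addr0 addrK.
    have vu : v * u = 1.
      by rewrite mulrDr mulr1 mulrBl mul1r -scalerAl -scalerAr rr !scaler0 subr0 subrK.
    have uev : u * e * v = e + t *: r.
      rewrite /u mulrDl mul1r -scalerAl re mulrBr mulr1 mulrDl.
      by rewrite -!scalerAr er -scalerAl rr !scaler0 addr0 subr0.
    have := stable _ (primitive_conj uv vu pe); rewrite uev.
    have -> : (e + t *: r) * a * (e + t *: r) =
        e * a * e + t *: (e * a * r + (r * a * e + t *: (r * a * r))).
      rewrite [_ * a]mulrDl mulrDl !mulrDr -!scalerAl -!scalerAr.
      by rewrite -addrA !scalerDr.
    rewrite mulrDr -scalerAr -ae => /addrI/(scalerI tn0) aE.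
    rewrite /X aE.
    by rewrite addrA [X in X - _]addrC addrK.
  have X1 := Xt 1 (oner_neq0 _); have Xt0 := Xt t0 t00.
  have rar : r * a * r = 0.
    have : (1 - t0) *: (r * a * r) = 0 by rewrite scalerBl -X1 -Xt0 subrr.
    by move/eqP; rewrite scaler_eq0 subr_eq0 eq_sym (negPf t01) => /eqP.
  by split=> //; apply/eqP; rewrite -subr_eq0 -/X X1 rar scaler0.
(* If e a (1 - e) were nonzero, some r would have e a r nonzero in eRe; then r (e a r) = r a r would
   be nonzero as well. *)
have ea : e * a = a * e.
  rewrite ae; apply/eqP; rewrite -subr_eq0 -{1}[e * a]mulr1 -mulrBr.
  set g := e * a * (1 - e); apply: contraT => g0.
  have [w gwe] := prime_neq0 primeR g0 e0.
  have [r [er re gr]] : exists r, [/\ e * r = 0, r * e = r & e * a * r = g * w * e].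
    exists ((1 - e) * w * e); split; last by rewrite /g !mulrA.
      by rewrite !mulrA mulrBr mulr1 ee subrr !mul0r.
    by rewrite -(mulrA _ e e) ee.
  have r0 : r != 0 by apply: contraNneq gwe => r0; rewrite -gr r0 mulr0.
  have [_ rar] := shear r er re.
  have := primitive_mul_neq0 primeR pe r0 gwe re.
  rewrite -gr !mulrA ee re rar eqxx; exact.
apply: (central_of_corner primeR e0 f0 ee) => // r er re.
have [-> _] := shear r er re.
by rewrite ea -mulrA er mulr0 add0r -mulrA -ea mulrA re.
Qed.

(** Both idempotents are conjugated by 1 + tE, where E is nonzero in [eps true] R [eps false] and so
    has square 0. The eight conditions (two elements, four entries) become the nonvanishing of eight
    quadratics in t, with at most 16 roots altogether. Each quadratic has a nonzero coefficient,
    obtained from the entry at (false, true) by multiplying with E on the left, the right, both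
    sides or neither. *)
Lemma generic_idempotents (eps : bool -> R) a a' (s : seq k) :
  (forall i, primitive_idem (eps i)) -> (forall i, eps i * eps (~~ i) = 0) ->
  eps false * a * eps true != 0 -> eps false * a' * eps true != 0 ->
  uniq s -> (16 < size s)%N ->
  exists eps' : bool -> R, [/\ forall i, primitive_idem (eps' i),
    forall i, eps' i * eps' (~~ i) = 0, forall i j, eps' i * a * eps' j != 0 &
    forall i j, eps' i * a' * eps' j != 0].
Proof.
move=> pe oe a0 a'0 us ss.
have ee i : eps i * eps i = eps i by case: (pe i).
have e0 i : eps i != 0 by case: (pe i) => _ [].
have [E [eE Ee E0]] : exists E, [/\ eps true * E = E, E * eps false = E & E != 0].
  have [w w0] := prime_neq0 primeR (e0 true) (e0 false).
  by exists (eps true * w * eps false); rewrite !mulrA ee -(mulrA _ (eps false)) ee.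
have fE : eps false * E = 0 by rewrite -eE mulrA (oe false) mul0r.
have Et : E * eps true = 0 by rewrite -Ee -mulrA (oe false) mulr0.
have EE : E * E = 0 by rewrite -{1}Ee -mulrA fE mulr0.
(* The coefficients of 1, t, t^2 in [eps i] (1 - tE) m (1 + tE) [eps j]. *)
pose q m i j := (eps i * m * eps j, eps i * (m * E - E * m) * eps j,
  - (eps i * (E * m * E) * eps j)).
have qP m i j : eps false * m * eps true != 0 ->
    [|| (q m i j).1.1 != 0, (q m i j).1.2 != 0 | (q m i j).2 != 0].
  move=> m0.
  have mE0 : eps false * m * E != 0.
    have -> : eps false * m * E = eps false * m * eps true * E.
      by rewrite -(mulrA _ (eps true)) eE.
    by apply: (primitive_mul_neq0 primeR (pe true)) => //; rewrite -(mulrA _ (eps true)) ee.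
  have Em0 x : x != 0 -> eps false * x = x -> E * x != 0.
    by move=> x0 fx; apply: (primitive_mul_neq0 primeR (pe false)).
  case: i; case: j; rewrite /q /=.
  - have -> : eps true * (m * E - E * m) * eps true = - (E * (eps false * m * eps true)).
      by rewrite mulrBr mulrBl !mulrA eE -(mulrA _ E) Et mulr0 sub0r Ee.
    by rewrite oppr_eq0 Em0 ?orbT // !mulrA ee.
  - have -> : eps true * (E * m * E) * eps false = E * (eps false * m * E).
      by rewrite !mulrA eE -(mulrA _ E (eps false)) Ee.
    by rewrite oppr_eq0 Em0 ?orbT // !mulrA ee.
  - by rewrite m0.
  - have -> : eps false * (m * E - E * m) * eps false = eps false * m * E.
      by rewrite mulrBr mulrBl !mulrA fE !mul0r subr0 -(mulrA _ E) Ee.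
    by rewrite mE0 orbT.
pose l := [seq q m i true | m <- [:: a; a'], i <- [:: true; false]] ++
  [seq q m i false | m <- [:: a; a'], i <- [:: true; false]].
have ql m i j : m \in [:: a; a'] -> q m i j \in l.
  move=> hm; rewrite mem_cat; apply/orP; case: j; [left | right].
    by apply/allpairsP; exists (m, i) => /=; split=> //; case: (i).
  by apply/allpairsP; exists (m, i) => /=; split=> //; case: (i).
have [||t _ tl] := quadratic_avoid_roots (l := l) us.
- by rewrite size_cat !size_allpairs.
- by move=> r; rewrite mem_cat => /orP[] /allpairsP[[m i] /=];
    rewrite !inE => -[/orP[]/eqP -> _ ->]; exact: qP.
pose u := 1 + t *: E; pose v := 1 - t *: E.
have uv : u * v = 1.
  by rewrite mulrBr mulr1 mulrDl mul1r -scalerAl -scalerAr EE !scaler0 addr0 addrK.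
have vu : v * u = 1.
  by rewrite mulrDr mulr1 mulrBl mul1r -scalerAl -scalerAr EE !scaler0 subr0 subrK.
have conj i j m : m \in [:: a; a'] ->
    u * eps i * v * m * (u * eps j * v) != 0.
  move=> /(ql _ i j)/tl /= nz; apply: contraNneq nz => h.
  have vmu : v * m * u = m + t *: (m * E - E * m) - t ^+ 2 *: (E * m * E).
    rewrite mulrDr mulr1 mulrBl mul1r -scalerAl -scalerAr mulrBl -scalerAl.
    by rewrite !scalerBr scalerA -expr2 !addrA [in RHS](addrAC m).
  have -> : eps i * m * eps j + t *: (eps i * (m * E - E * m) * eps j) +
      t ^+ 2 *: - (eps i * (E * m * E) * eps j) = eps i * (v * m * u) * eps j.
    rewrite vmu; move: (m * E - E * m) (E * m * E) => X Y.
    rewrite mulrBr mulrDr mulrBl mulrDl.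
    by rewrite -!scalerAr -!scalerAl scalerN.
  have -> : eps i * (v * m * u) * eps j =
      v * (u * eps i * v * m * (u * eps j * v)) * u.
    by rewrite !mulrA vu mul1r -!mulrA vu mulr1.
  by rewrite h mulr0 mul0r.
exists (fun i => u * eps i * v); split=> [i|i|i j|i j].
- exact: primitive_conj.
- by rewrite !mulrA -(mulrA (u * eps i) v u) vu mulr1 -(mulrA u) oe mulr0 mul0r.
- by apply: conj; rewrite inE eqxx.
- by apply: conj; rewrite !inE eqxx orbT.
Qed.

End GenericPosition.

Section MovedIdempotents.
Variables (k : fieldType) (R : algType k).
Hypothesis primeR : prime_ring R.
Hypothesis minimalR : forall f : R, f != 0 -> exists z, minimal_right (f * z).
Hypothesis zero_divisorsR : exists y z : R, [/\ y != 0, z != 0 & y * z = 0].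

Lemma moved_idempotents (a a' : R) (s : seq k) :
  a * a' = 1 -> a' * a = 1 -> ~ (forall x, a * x = x * a) ->
  uniq s -> (16 < size s)%N ->
  exists eps : bool -> R, [/\ forall i, primitive_idem (eps i),
    forall i, eps i * eps (~~ i) = 0, forall i j, eps i * a * eps j != 0 &
    forall i j, eps i * a' * eps j != 0].
Proof.
move=> aa' a'a nca us ss.
have [g [pg _ _]] : exists e : R, [/\ primitive_idem e, 1 * e = e & e * 1 = e].
  by apply: (primitive_idem_exists primeR (mul1r _)); apply: minimalR; exact: oner_neq0.
(* If 1 were primitive, R would be a division ring, contrary to the zero divisors. *)
have g1 : g != 1.
  apply/eqP => g1; have [y [z [y0 z0 yz]]] := zero_divisorsR.
  have [||x [_ _ _ xy]] := primitive_corner_inv pg y0; rewrite ?g1 ?mul1r ?mulr1 //.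
  by move: z0; rewrite -[z]mul1r -g1 -xy -mulrA yz mulr0 eqxx.
have [t0 [t00 t01]] : exists t0 : k, t0 != 0 /\ t0 != 1.
  case: s us ss => [|x [|y [|z s]]] //; rewrite /= !inE !negb_or => /and4P[].
  case/and3P=> xy xz _ /andP[yz _] _ _ _.
  have [x0|x0] := eqVneq x 0; last first.
    have [x1|x1] := eqVneq x 1; last by exists x.
    have [y0|y0] := eqVneq y 0; last by exists y; rewrite y0 -x1 eq_sym.
    by exists z; rewrite -y0 -x1 ![z == _]eq_sym.
  have [y1|y1] := eqVneq y 1; last by exists y; rewrite -x0 eq_sym.
  by exists z; rewrite -x0 -y1 ![z == _]eq_sym.
have [e pe ae] := primitive_moved_exists primeR pg g1 t00 t01 nca.
have [ee [e0 _]] := pe.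
(* If a' e lay in eRe, it would be invertible there, and its inverse would be a e; then a e would
   lie in eRe, against the choice of e. *)
have a'e : (1 - e) * a' * e != 0.
  apply: contraNneq ae => a'e; set x := e * a' * e.
  have xE : a' * e = x.
    by apply/eqP; rewrite -subr_eq0 /x -{1}[a' * e]mul1r -(mulrA e) -mulrBl mulrA a'e.
  have x0 : x != 0.
    by apply: contraNneq e0 => x0; rewrite -[e]mul1r -aa' -mulrA xE x0 mulr0.
  have [||y [ey ye xy _]] := primitive_corner_inv pe x0.
  - by rewrite /x !mulrA ee.
  - by rewrite /x -(mulrA _ e e) ee.
  have -> : (1 - e) * a * e = (1 - e) * y.
    rewrite -mulrA; congr (_ * _).
    by rewrite -[in LHS]xy -xE !mulrA aa' mul1r ey.
  by rewrite mulrBl mul1r ey subrr.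
have [||||e' [pe' ee' e'e y0 z0]] := primitive_orthogonal_exists primeR pe ae a'e.
- by rewrite !mulrA mulrBr mulr1 ee subrr !mul0r.
- by rewrite !mulrA mulrBr mulr1 ee subrr !mul0r.
- by rewrite -(mulrA _ e e) ee.
- by rewrite -(mulrA _ e e) ee.
apply: (generic_idempotents primeR (eps := fun b => if b then e else e') _ _ _ _ us ss).
- by case.
- by case.
- by move: y0; rewrite !mulrA mulrBr mulr1 e'e subr0.
- by move: z0; rewrite !mulrA mulrBr mulr1 e'e subr0.
Qed.

End MovedIdempotents.

(** * Minimal right ideals and finite scalars in finite dimension *)

Section FiniteDimensional.
Variables (k : fieldType) (R : algType k) (n : nat) (b : 'I_n -> R).
Variable co : R -> 'rV[k]_n.
Hypothesis co_sum : forall x, x = \sum_i co x 0 i *: b i.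

(** In coordinates, the row space of [M y] is the right ideal yR. For a nonzero f z with [M] of
    least rank, any nonzero f z w spans the same ideal and so gives back f z. *)
Lemma minimal_right_exists (co_lin : linear co) (f : R) :
  f != 0 -> exists z, minimal_right (f * z).
Proof.
move=> f0.
have coZ c x : co (c *: x) = c *: co x.
  have co0 : co 0 = 0 by have := co_lin (-1) 0 0; rewrite scaler0 addr0 scaleN1r addNr.
  by have := co_lin c x 0; rewrite co0 !addr0.
have co_bigsum (I : finType) (c : I -> k) (x : I -> R) :
    co (\sum_i c i *: x i) = \sum_i c i *: co (x i).
  elim: (index_enum I) => [|i r IH].
    by rewrite !big_nil; have := coZ 0 0; rewrite !scale0r.
  by rewrite !big_cons co_lin IH.
pose M y := \matrix_(i < n) co (y * b i).
have subM (y w : R) : (M (y * w)%R <= M y)%MS.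
  apply/row_subP => i; rewrite rowK -mulrA {1}[w * b i]co_sum mulr_sumr.
  under eq_bigr do rewrite -scalerAr.
  rewrite co_bigsum; apply: summx_sub => j _; apply: scalemx_sub.
  by rewrite -(rowK (fun j => co (y * b j)) j) row_sub.
have ex : exists m, `[< exists2 z, f * z != 0 & \rank (M (f * z)) = m >].
  by exists (\rank (M (f * 1))); apply/asboolP; exists 1; rewrite ?mulr1.
case: (ex_minnP ex) => m /asboolP[z fz0 rz] minm.
exists z; split=> // w fzw.
have : (M (f * z)%R <= M (f * z * w)%R)%MS.
  rewrite -(geq_leqif (mxrank_leqif_sup (subM _ _))) rz minm //.
  by apply/asboolP; exists (z * w); rewrite mulrA.
have yM : (co (f * z)%R <= M (f * z)%R)%MS.
  by rewrite -{1}[f * z]mulr1 {1}[1]co_sum mulr_sumr; under eq_bigr do rewrite -scalerAr;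
     rewrite co_bigsum; apply: summx_sub => j _; apply: scalemx_sub;
     rewrite -(rowK (fun j => co (f * z * b j)) j) row_sub.
move=> /(submx_trans yM)/submxP[D DE].
exists (\sum_i D 0 i *: b i).
have -> : f * z * w * (\sum_i D 0 i *: b i) = \sum_i D 0 i *: (f * z * w * b i).
  by rewrite mulr_sumr; apply: eq_bigr => i _; rewrite scalerAr.
have coE : co (\sum_i D 0 i *: (f * z * w * b i)) = co (f * z).
  rewrite co_bigsum DE mulmx_sum_row; apply: eq_bigr => i _; by rewrite rowK.
by rewrite [LHS]co_sum coE -co_sum.
Qed.

(** The combinations of the [b i] with coefficients in [k0] form a finite subring containing x and
    y, and Wedderburn's theorem applies to it. There are two uses: over a finite subfield of the
    residue field, and for showing that the centre of a noncommutative K is infinite. *)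
Lemma finite_scalars_mulrC (k0 : seq k) (x y : R) :
  1 \in k0 -> {in k0 &, forall s t, s - t \in k0} -> {in k0 &, forall s t, s * t \in k0} ->
  (forall i j l, co (b i * b j) 0 l \in k0) -> (forall l, co 1 0 l \in k0) ->
  (forall l, co x 0 l \in k0) -> (forall l, co y 0 l \in k0) ->
  (forall u v : R, u * v = 0 -> (u == 0) || (v == 0)) -> x * y = y * x.
Proof.
move=> k1 kB kM kb k11 kx ky dom.
pose comb (c : {ffun 'I_n -> seq_sub k0}) := \sum_i val (c i) *: b i.
pose A0 := [seq comb c | c : {ffun 'I_n -> seq_sub k0}].
have A0P u : u \in A0 <-> exists2 c : 'I_n -> k, (forall i, c i \in k0) & u = \sum_i c i *: b i.
  split=> [/mapP[c _ ->]|[c ck ->]].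
    by exists (fun i => val (c i)) => // i; exact: (valP (c i)).
  apply/mapP; exists [ffun i => SeqSub (ck i)]; rewrite ?mem_enum //.
  by apply: eq_bigr => i _; rewrite ffunE.
have k00 : 0 \in k0 by rewrite -(subrr 1) kB.
have kD : {in k0 &, forall s t, s + t \in k0}.
  by move=> s t sk tk; rewrite -[t]opprK -[- t]sub0r !kB.
have kS (I : finType) (c : I -> k) : (forall i, c i \in k0) -> \sum_i c i \in k0.
  by move=> ck; elim/big_ind: _ => // s t; exact: kD.
apply: (@finite_domain_mulrC R A0).
- by apply/A0P; exists (co 1 0) => //; exact: co_sum.
- move=> _ _ /A0P[c ck ->] /A0P[d dk ->]; apply/A0P; exists (fun i => c i - d i).
    by move=> i; rewrite kB.
  by rewrite -sumrB; apply: eq_bigr => i _; rewrite scalerBl.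
- move=> _ _ /A0P[c ck ->] /A0P[d dk ->]; apply/A0P.
  exists (fun l => \sum_i \sum_j c i * d j * co (b i * b j) 0 l).
    by move=> l; apply: (kS) => i; apply: (kS) => j; rewrite !kM.
  rewrite mulr_suml; under eq_bigr do rewrite mulr_sumr.
  under [RHS]eq_bigr do rewrite scaler_suml.
  rewrite [RHS]exchange_big; apply: eq_bigr => i _ /=.
  under [RHS]eq_bigr do rewrite scaler_suml.
  rewrite [RHS]exchange_big; apply: eq_bigr => j _ /=.
  rewrite -scalerAl -scalerAr scalerA {1}[b i * b j]co_sum scaler_sumr.
  by apply: eq_bigr => l _; rewrite scalerA.
- by move=> u v _ _; exact: dom.
- by apply/A0P; exists (co x 0) => //; exact: co_sum.
- by apply/A0P; exists (co y 0) => //; exact: co_sum.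
Qed.

End FiniteDimensional.

Lemma common_exponent p (k : fieldType) (s : seq k) : algebraic_over_Fp p k ->
  exists2 m, (0 < m)%N & forall z, z \in s -> z ^+ (p ^ m) = z.
Proof.
move=> [_ algk].
have iter (z : k) m r : z ^+ (p ^ m) = z -> z ^+ (p ^ (m * r)) = z.
  move=> zm; elim: r => [|r IH]; first by rewrite muln0 expn0 expr1.
  by rewrite mulnS expnD exprM zm.
elim: s => [|z s [m m0 sm]]; first by exists 1%N.
have [r r0 zr] := algk z.
exists (m * r)%N => [|y]; first by rewrite muln_gt0 m0.
by rewrite inE => /orP[/eqP ->|/sm ym]; [rewrite mulnC |]; exact: iter.
Qed.

(** X^(p^m) - X has at most p^m roots, and a longest list of distinct roots contains them all. *)
Lemma frobenius_fixed_seq p (k : fieldType) m : p \in [pchar k] -> (0 < m)%N ->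
  exists s : seq k, forall z, (z \in s) = (z ^+ (p ^ m) == z).
Proof.
move=> pk m0; have p_pr := pcharf_prime pk.
pose P : {poly k} := 'X^(p ^ m) - 'X.
have p1 : (1 < p ^ m)%N by rewrite -(expn0 p) ltn_exp2l ?prime_gt1.
have sP : size P = (p ^ m).+1.
  by rewrite size_polyDl size_polyXn // size_polyN size_polyX.
have P0 : P != 0 by rewrite -size_poly_gt0 sP.
have rP z : root P z = (z ^+ (p ^ m) == z) by rewrite rootE !hornerE subr_eq0.
pose good n := `[< exists s : seq k, [/\ uniq s, all (root P) s & size s = n] >].
have ex : exists n, good n by exists 0%N; apply/asboolP; exists [::].
have bound n : good n -> (n <= p ^ m)%N.
  by move=> /asboolP[s [us rs <-]]; rewrite -ltnS -sP max_poly_roots.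
case: (ex_maxnP ex bound) => n /asboolP[s [us rs sn]] maxn.
exists s => z; rewrite -rP; apply/idP/idP => [zs|rz]; first exact: (allP rs).
apply: contraT => zs; have := maxn n.+1; rewrite ltnn; apply.
by apply/asboolP; exists (z :: s); rewrite /= zs us rz rs sn.
Qed.

(** The coordinates of x, y, 1 and of the products of the [b i] are finitely many scalars, hence all
    fixed by one iterate of Frobenius, whose fixed points form a finite subfield. The contrapositive
    supplies zero divisors in the residue algebra. *)
Lemma algebraic_domain_mulrC p (k : fieldType) (R : algType k) n (b : 'I_n -> R)
    (co : R -> 'rV[k]_n) :
  (forall x, x = \sum_i co x 0 i *: b i) -> algebraic_over_Fp p k ->
  (forall u v : R, u * v = 0 -> (u == 0) || (v == 0)) ->
  forall x y : R, x * y = y * x.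
Proof.
move=> co_sum algk dom x y; have [pk _] := algk.
pose entries u := [seq co u 0 l | l : 'I_n].
have [m m0 fixed] := common_exponent (entries x ++ entries y ++ entries 1 ++
  flatten [seq entries (b i * b j) | i <- enum 'I_n, j <- enum 'I_n]) algk.
have [s sP] := frobenius_fixed_seq pk m0.
have pnat : [pchar k].-nat (p ^ m)%N by rewrite pnatX pnatE ?(pcharf_prime pk) // pk.
apply: (finite_scalars_mulrC co_sum (k0 := s)) => //.
- by rewrite sP expr1n.
- move=> u v; rewrite !sP => /eqP uE /eqP vE.
  by rewrite exprDn_pchar // exprNn_pchar // uE vE.
- by move=> u v; rewrite !sP => /eqP uE /eqP vE; rewrite exprMn uE vE.
- move=> i j l; rewrite sP fixed // !mem_cat; apply/orP; right; apply/orP; right.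
  apply/orP; right; apply/flattenP; exists (entries (b i * b j)).
    by apply/allpairsP; exists (i, j); rewrite !mem_enum.
  by rewrite map_f // mem_enum.
- by move=> l; rewrite sP fixed // !mem_cat [_ \in entries 1]map_f ?orbT // mem_enum.
- by move=> l; rewrite sP fixed // !mem_cat [_ \in entries x]map_f // mem_enum.
- by move=> l; rewrite sP fixed // !mem_cat [_ \in entries y]map_f ?orbT // mem_enum.
Qed.

(** * Algebras over the residue field *)

Section StructureConstants.
Variables (k : fieldType) (n : nat).
Variables (mul : 'rV[k]_n -> 'rV[k]_n -> 'rV[k]_n) (one : 'rV[k]_n).
Hypotheses (mulA : associative mul) (mul1x : left_id one mul) (mulx1 : right_id one mul)
  (mulDl : left_distributive mul +%R) (mulDr : right_distributive mul +%R)
  (mulZl : forall c x y, c *: mul x y = mul (c *: x) y)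
  (mulZr : forall c x y, c *: mul x y = mul x (c *: y)) (one_neq0 : one != 0).

Definition structure_algebra := 'rV[k]_n.
HB.instance Definition _ := GRing.Lmodule.on structure_algebra.
HB.instance Definition _ := GRing.Zmodule_isNzRing.Build structure_algebra
  mulA mul1x mulx1 mulDl mulDr one_neq0.
HB.instance Definition _ := GRing.Lmodule_isLalgebra.Build k structure_algebra mulZl.
HB.instance Definition _ := GRing.Lalgebra_isAlgebra.Build k structure_algebra mulZr.

(** The existential form allows a product that is constructed inside a proof to be turned into an
    [algType]. *)
Lemma structure_algebra_exists : exists (R : algType k) (f : 'rV[k]_n -> R) (g : R -> 'rV[k]_n),
  [/\ cancel f g, linear f, linear g,
      forall x y, f (mul x y) = f x * f y & f one = 1] /\ cancel g f.
Proof. by exists structure_algebra, id, id. Qed.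

End StructureConstants.

(** * Coordinate functions as elementary operators *)

Section Density.
Variables (F : fieldType) (K : algType F) (n : nat) (b : 'I_n -> K).
Variable co : K -> 'rV[F]_n.
Hypothesis co_lin : linear co.
Hypothesis co_sum : forall x, x = \sum_i co x 0 i *: b i.
Hypothesis co_b : forall i, co (b i) = delta_mx 0 i.
Hypothesis divK : forall x : K, x != 0 -> exists2 y, x * y = 1 & y * x = 1.
Hypothesis centerK : forall x : K, (forall y, x * y = y * x) -> exists c, x = c%:A.

(** The action on K of the tensor sum of t.1 (x) t.2, as left and right multiplications. *)
Definition elementary_op (T : seq (K * K)) (x : K) : K := \sum_(t <- T) t.1 * x * t.2.

Lemma elementary_opMl c T x : elementary_op [seq (c * t.1, t.2) | t <- T] x = c * elementary_op T x.
Proof.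
by rewrite /elementary_op big_map mulr_sumr; apply: eq_bigr => t _; rewrite !mulrA.
Qed.

Lemma elementary_opMr c T x : elementary_op [seq (t.1, t.2 * c) | t <- T] x = elementary_op T x * c.
Proof.
by rewrite /elementary_op big_map mulr_suml; apply: eq_bigr => t _; rewrite !mulrA.
Qed.

Lemma elementary_op_cat T S x : elementary_op (T ++ S) x = elementary_op T x + elementary_op S x.
Proof. by rewrite /elementary_op big_cat. Qed.

Lemma elementary_op_sum (J : seq 'I_n) (f : 'I_n -> K) (S : 'I_n -> seq (K * K)) T :
  exists T', forall x, elementary_op T' x =
    elementary_op T x - \sum_(i <- J) f i * elementary_op (S i) x.
Proof.
elim: J => [|i J [T' T'E]]; first by exists T => x; rewrite big_nil subr0.
exists ([seq (- f i * t.1, t.2) | t <- S i] ++ T') => x.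
by rewrite elementary_op_cat elementary_opMl T'E big_cons opprD addrCA mulNr.
Qed.

(* Artin-Whaples: an operator killing all but the last of a family of
   vectors must exist, since otherwise the last one would be a combination of
   the others with coefficients commuting with everything. *)
Lemma dual_ops_seq (J : seq 'I_n) : uniq J -> exists S : 'I_n -> seq (K * K),
  forall i j, i \in J -> j \in J -> elementary_op (S j) (b i) = (i == j)%:R.
Proof.
elim: J => [_|m J IH /= /andP[mJ uJ]]; first by exists (fun _ => [::]).
have [S SP] := IH uJ.
have sumS (f : 'I_n -> K) i : i \in J ->
    \sum_(j <- J) f j * elementary_op (S j) (b i) = f i.
  move=> iJ; rewrite (bigD1_seq i) //= SP // eqxx mulr1 big_seq_cond big1 ?addr0 // => j.
  by case/andP=> jJ ji; rewrite SP // eq_sym (negPf ji) mulr0.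
have [T [Tm TJ]] : exists T, elementary_op T (b m) != 0 /\
    forall i, i \in J -> elementary_op T (b i) = 0.
  apply: contrapT => noT.
  pose t i := elementary_op (S i) (b m).
  (* T minus the sum of the T(b i) S_i kills b i for all i in J, hence also b m by the assumption
     [noT]. *)
  have tP T : elementary_op T (b m) = \sum_(i <- J) elementary_op T (b i) * t i.
    have [T' T'E] := elementary_op_sum J (fun i => elementary_op T (b i)) S T.
    apply/eqP; rewrite -subr_eq0 -T'E; apply: contrapT => /negP h.
    by apply: noT; exists T'; split=> // i iJ; rewrite T'E sumS ?subrr.
  (* [tP], applied to S_j followed by right multiplication by z, reads t_j z = z t_j. *)
  have tc j : j \in J -> exists c, t j = c%:A.
    move=> jJ; apply: centerK => z.
    have := tP [seq (t.1, t.2 * z) | t <- S j]; rewrite elementary_opMr -/(t j) => ->.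
    rewrite (bigD1_seq j) //= elementary_opMr SP // eqxx mul1r big_seq_cond.
    rewrite big1 ?addr0 // => i /andP[iJ ij].
    by rewrite elementary_opMr SP // (negPf ij) !mul0r.
  have := tP [:: (1, 1)]; rewrite /elementary_op big_seq1 mul1r mulr1 => bm.
  have co0 : co 0 = 0 by have := co_lin (-1) 0 0; rewrite scaler0 addr0 scaleN1r addNr.
  have : co (b m) 0 m = 0.
    rewrite bm big_seq; elim/big_ind: _ => [|x y hx hy|i iJ].
    - by rewrite co0 mxE.
    - by have := co_lin 1 x y; rewrite !scale1r => ->; rewrite mxE hx hy addr0.
    rewrite big_seq1 mul1r mulr1; have [c ->] := tc i iJ.
    have := co_lin c (b i) 0; rewrite !addr0 co0 addr0 mulr_algr => ->.
    by rewrite co_b !mxE eqxx /=; case: eqP mJ => [->|]; rewrite ?iJ ?mulr0.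
  by rewrite co_b mxE !eqxx => /eqP; rewrite oner_eq0.
have [u Tu uT] := divK Tm.
pose Sm := [seq (u * t.1, t.2) | t <- T].
have SmE x : elementary_op Sm x = u * elementary_op T x by exact: elementary_opMl.
have ex j : exists T', forall x, elementary_op T' x =
    elementary_op (S j) x - elementary_op (S j) (b m) * elementary_op Sm x.
  have [T' T'E] := elementary_op_sum [:: j] (fun j => elementary_op (S j) (b m)) (fun=> Sm) (S j).
  by exists T' => x; rewrite T'E big_seq1.
have [S' S'E] := boolp.choice ex.
exists (fun j => if j == m then Sm else S' j) => i j.
rewrite !inE => /orP[/eqP ->|iJ] /orP[/eqP ->|jJ]; rewrite ?eqxx.
- by rewrite SmE uT.
- have jm : j != m by apply: contraNneq mJ => <-.
  by rewrite (negPf jm) S'E SmE uT mulr1 subrr eq_sym (negPf jm).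
- have im : i != m by apply: contraNneq mJ => <-.
  by rewrite SmE TJ // mulr0 (negPf im).
- have jm : j != m by apply: contraNneq mJ => <-.
  by rewrite (negPf jm) S'E SmE TJ // !mulr0 subr0 SP.
Qed.

(** Elementary operators are linear over F, so those dual to the basis compute coordinates. Each
    involves finitely many elements of K; once these are integral the identity can be reduced, which
    is how primeness reaches the residue algebra. *)
Lemma coordinate_ops : exists S : 'I_n -> seq (K * K),
  forall j x, elementary_op (S j) x = (co x 0 j)%:A.
Proof.
have [S SP] := dual_ops_seq (enum_uniq 'I_n).
exists S => j x; rewrite {1}[x]co_sum /elementary_op.
under eq_bigr do rewrite mulr_sumr mulr_suml.
rewrite exchange_big /= (bigD1 j) //= [X in _ + X]big1 => [|i ij].
  rewrite addr0; under eq_bigr do rewrite -scalerAr -scalerAl.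
  by rewrite -scaler_sumr -/(elementary_op (S j) (b j)) SP ?mem_enum // eqxx.
under eq_bigr do rewrite -scalerAr -scalerAl.
by rewrite -scaler_sumr -/(elementary_op (S j) (b i)) SP ?mem_enum // (negPf ij) scaler0.
Qed.

End Density.

(** * Integral forms and their reduction *)

Section ResidueMapTheory.
Variables (F k : fieldType) (O : F -> Prop) (h : F -> k).
Hypothesis resO : residue_map O h.

Lemma res_in0 : O 0.
Proof. by rewrite -(subrr 1); apply: (res_inB resO); exact: (res_in1 resO). Qed.

Lemma res0 : h 0 = 0.
Proof.
have O1 := res_in1 resO.
by rewrite -(subrr 1) (resB resO O1 O1) subrr.
Qed.

Lemma res_inN x : O x -> O (- x).
Proof. by rewrite -sub0r; apply: (res_inB resO); exact: res_in0. Qed.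

Lemma res_inD x y : O x -> O y -> O (x + y).
Proof. by move=> Ox Oy; rewrite -[y]opprK; apply: (res_inB resO) => //; exact: res_inN. Qed.

Lemma resD x y : O x -> O y -> h (x + y) = h x + h y.
Proof.
move=> Ox Oy; rewrite -{1}[y]opprK (resB resO) //; last exact: res_inN.
by rewrite -[- y]sub0r (resB resO) ?res0 ?sub0r ?opprK //; exact: res_in0.
Qed.

(** m indexes an entry of least valuation; it is found by comparing the current candidate with each
    further entry through [res_total]. *)
Lemma dominant_coordinate (I : finType) (f : I -> F) i : f i != 0 ->
  exists2 m, f m != 0 & forall l, O (f l / f m).
Proof.
move=> fi.
have [h0|[m [fm Om]]] : (forall l, l \in enum I -> f l = 0) \/
    exists m, f m != 0 /\ forall l, l \in enum I -> O (f l / f m).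
- elim: (enum I) => [|l J [h0|[m [fm Om]]]]; first by left.
    have [fl|fl] := eqVneq (f l) 0.
      by left=> l'; rewrite inE => /orP[/eqP ->|/h0].
    right; exists l; split=> // l'; rewrite inE => /orP[/eqP ->|/h0 ->].
      by rewrite divff //; exact: (res_in1 resO).
    by rewrite mul0r; exact: res_in0.
  right; have [fl|fl] := eqVneq (f l) 0.
    exists m; split=> // l'; rewrite inE => /orP[/eqP ->|/Om //].
    by rewrite fl mul0r; exact: res_in0.
  have [Olm|[Oml _]] := res_total resO (f l / f m).
    by exists m; split=> // l'; rewrite inE => /orP[/eqP ->|/Om].
  exists l; split=> // l'; rewrite inE => /orP[/eqP ->|/Om Ol'].
    by rewrite divff //; exact: (res_in1 resO).
  rewrite invf_div in Oml.
  have -> : f l' / f l = (f l' / f m) * (f m / f l) by rewrite mulrA divfK.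
  exact: (res_inM resO).
- by move: fi; rewrite h0 ?mem_enum ?eqxx.
- by exists m => // l; apply: Om; rewrite mem_enum.
Qed.

End ResidueMapTheory.

(* L is the integral form of K over the valuation ring O; its reduction is the
   algebra R over the residue field. *)
Record good_reduction (F k : fieldType) (O : F -> Prop) (h : F -> k)
    (K : algType F) (R : algType k) (L : K -> Prop) (pi : K -> R) : Prop :=
  GoodReduction {
    gr_in1 : L 1;
    gr_inB : forall x y, L x -> L y -> L (x - y);
    gr_inM : forall x y, L x -> L y -> L (x * y);
    gr_inZ : forall c x, O c -> L x -> L (c *: x);
    gr1 : pi 1 = 1;
    grB : forall x y, L x -> L y -> pi (x - y) = pi x - pi y;
    grM : forall x y, L x -> L y -> pi (x * y) = pi x * pi y;
    grZ : forall c x, O c -> L x -> pi (c *: x) = h c *: pi x;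
    gr_onto : forall y, exists2 x, L x & pi x = y;
    gr_scale : forall x, x != 0 ->
      exists c, [/\ c != 0, L (c *: x) & pi (c *: x) != 0];
    gr_scalar : forall c, L c%:A -> O c }.

Section Reduction.
Variables (F k : fieldType) (O : F -> Prop) (h : F -> k).
Hypothesis resO : residue_map O h.
Variables (K : algType F) (n : nat) (b : 'I_n -> K) (co : K -> 'rV[F]_n).
Hypothesis co_lin : linear co.
Hypothesis co_sum : forall x, x = \sum_i co x 0 i *: b i.
Hypothesis co_b : forall i, co (b i) = delta_mx 0 i.
Variable S : 'I_n -> seq (K * K).
Hypothesis SP : forall j x, elementary_op (S j) x = (co x 0 j)%:A.

Definition integral_elt (x : K) : Prop := forall i, O (co x 0 i).

Hypothesis int1 : integral_elt 1.
Hypothesis intb : forall i j, integral_elt (b i * b j).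
Hypothesis intS : forall j t, t \in S j -> integral_elt t.1 /\ integral_elt t.2.

Let co0 : co 0 = 0.
Proof. by have := co_lin (-1) 0 0; rewrite scaler0 addr0 scaleN1r addNr. Qed.

Let coZ c x : co (c *: x) = c *: co x.
Proof. by have := co_lin c x 0; rewrite !addr0 co0 addr0. Qed.

Let coD x y : co (x + y) = co x + co y.
Proof. by have := co_lin 1 x y; rewrite !scale1r. Qed.

Let coB x y : co (x - y) = co x - co y.
Proof. by rewrite coD -[- y]scaleN1r coZ scaleN1r. Qed.

Let int0 : integral_elt 0.
Proof. by move=> i; rewrite co0 mxE; exact: (res_in0 resO). Qed.

Let intD x y : integral_elt x -> integral_elt y -> integral_elt (x + y).
Proof. by move=> ix iy i; rewrite coD mxE; exact: (res_inD resO). Qed.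

Let intB x y : integral_elt x -> integral_elt y -> integral_elt (x - y).
Proof. by move=> ix iy i; rewrite coB !mxE; exact: (res_inB resO). Qed.

Let intZ c x : O c -> integral_elt x -> integral_elt (c *: x).
Proof. by move=> Oc ix i; rewrite coZ mxE; exact: (res_inM resO). Qed.

Let int_sum (I : finType) (x : I -> K) :
  (forall i, integral_elt (x i)) -> integral_elt (\sum_i x i).
Proof. by move=> ix; elim/big_ind: _ => // *; exact: intD. Qed.

Let mul_sum x y : x * y = \sum_i \sum_j (co x 0 i * co y 0 j) *: (b i * b j).
Proof.
rewrite {1}[x]co_sum mulr_suml; apply: eq_bigr => i _.
rewrite {1}[y]co_sum mulr_sumr; apply: eq_bigr => j _.
by rewrite -scalerAl -scalerAr scalerA.
Qed.

Let intM x y : integral_elt x -> integral_elt y -> integral_elt (x * y).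
Proof.
move=> ix iy; rewrite mul_sum; apply: int_sum => i; apply: int_sum => j.
by apply: intZ => //; exact: (res_inM resO).
Qed.

Let red (x : K) : 'rV[k]_n := \row_i h (co x 0 i).

Let redD x y : integral_elt x -> integral_elt y -> red (x + y) = red x + red y.
Proof. by move=> ix iy; apply/rowP => i; rewrite !mxE coD mxE (resD resO). Qed.

Let redB x y : integral_elt x -> integral_elt y -> red (x - y) = red x - red y.
Proof. by move=> ix iy; apply/rowP => i; rewrite !mxE coB !mxE (resB resO). Qed.

Let redZ c x : O c -> integral_elt x -> red (c *: x) = h c *: red x.
Proof. by move=> Oc ix; apply/rowP => i; rewrite !mxE coZ mxE (resM resO). Qed.

Let red_sum (I : finType) (x : I -> K) : (forall i, integral_elt (x i)) ->
  red (\sum_i x i) = \sum_i red (x i).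
Proof.
move=> ix; suff : integral_elt (\sum_i x i) /\ red (\sum_i x i) = \sum_i red (x i) by case.
elim: (index_enum I) => [|i r [ir IH]].
  rewrite !big_nil; split=> //; apply/rowP => i.
  by rewrite !mxE co0 mxE (res0 resO).
by rewrite !big_cons redD // IH; split=> //; exact: intD.
Qed.

Let red_onto (u : 'rV[k]_n) : exists2 x, integral_elt x & red x = u.
Proof.
have ex i : exists c, O c /\ h c = u 0 i.
  by have [c Oc hc] := res_onto resO (u 0 i); exists c.
have [c cP] := boolp.choice ex.
have co_c : co (\sum_i c i *: b i) = \row_i c i.
  rewrite [RHS]row_sum_delta.
  elim: (index_enum _) => [|i r IH]; first by rewrite !big_nil.
  by rewrite !big_cons co_lin IH co_b mxE.
exists (\sum_i c i *: b i).
  by move=> i; rewrite co_c mxE; case: (cP i).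
by apply/rowP => i; rewrite mxE co_c mxE; case: (cP i).
Qed.

Let mul (u v : 'rV[k]_n) := \sum_i \sum_j (u 0 i * v 0 j) *: red (b i * b j).

Let redM x y : integral_elt x -> integral_elt y -> red (x * y) = mul (red x) (red y).
Proof.
move=> ix iy; rewrite mul_sum red_sum => [|i]; last first.
  by apply: int_sum => j; apply: intZ => //; exact: (res_inM resO).
apply: eq_bigr => i _; rewrite red_sum => [|j]; last first.
  by apply: intZ => //; exact: (res_inM resO).
apply: eq_bigr => j _; rewrite redZ //; last exact: (res_inM resO).
by rewrite !mxE (resM resO).
Qed.

(** Associativity and the unit laws on k^n are obtained by lifting to integral elements, computing
    in K and reducing. For primeness, the reduced coordinate operator writes h(x_j) 1 as a sum of u
    y v, where x lifts y. If y R z = 0 and some h(x_j) is nonzero, then z = 0. *)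
Lemma good_reduction_exists : exists (R : algType k) (pi : K -> R),
  [/\ good_reduction O h integral_elt pi, prime_ring R &
    exists (b' : 'I_n -> R) (co' : R -> 'rV[k]_n), linear co' /\
      forall y, y = \sum_i co' y 0 i *: b' i].
Proof.
have mulA : associative mul.
  move=> u v w; have [x ix <-] := red_onto u; have [y iy <-] := red_onto v.
  have [z iz <-] := red_onto w.
  by rewrite -!redM ?mulrA //; exact: intM.
have mul1x : left_id (red 1) mul.
  by move=> u; have [x ix <-] := red_onto u; rewrite -redM // mul1r.
have mulx1 : right_id (red 1) mul.
  by move=> u; have [x ix <-] := red_onto u; rewrite -redM // mulr1.
have mulDl : left_distributive mul +%R.
  move=> u v w; rewrite /mul -big_split; apply: eq_bigr => i _ /=.
  by rewrite -big_split; apply: eq_bigr => j _; rewrite mxE mulrDl scalerDl.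
have mulDr : right_distributive mul +%R.
  move=> u v w; rewrite /mul -big_split; apply: eq_bigr => i _ /=.
  by rewrite -big_split; apply: eq_bigr => j _; rewrite mxE mulrDr scalerDl.
have mulZl c u v : c *: mul u v = mul (c *: u) v.
  rewrite /mul scaler_sumr; apply: eq_bigr => i _; rewrite scaler_sumr.
  by apply: eq_bigr => j _; rewrite mxE scalerA mulrA.
have mulZr c u v : c *: mul u v = mul u (c *: v).
  rewrite /mul scaler_sumr; apply: eq_bigr => i _; rewrite scaler_sumr.
  by apply: eq_bigr => j _; rewrite mxE scalerA mulrCA.
have red_b i : red (b i) = delta_mx 0 i.
  apply/rowP => j; rewrite !mxE co_b mxE; case: (_ && _).
    exact: (res1 resO).
  exact: (res0 resO).
have co_neq0 (x : K) : x != 0 -> exists i, co x 0 i != 0.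
  move=> x0; apply: contrapT => no_i; move/negP: x0; apply.
  rewrite [x]co_sum big1 // => i _; suff -> : co x 0 i = 0 by rewrite scale0r.
  by apply/eqP; apply: contrapT => /negP ?; apply: no_i; exists i.
have one_neq0 : red 1 != 0.
  have [i _] := co_neq0 1 (oner_neq0 _).
  apply/eqP => r1; have := mul1x (red (b i)); rewrite r1 -(scale0r 0) -mulZl scale0r red_b.
  by move/rowP/(_ i)/eqP; rewrite !mxE !eqxx eq_sym oner_eq0.
have [R [f [g [[fK f_lin g_lin fM f1] gK]]]] :=
  structure_algebra_exists mulA mul1x mulx1 mulDl mulDr mulZl mulZr one_neq0.
have f0 : f 0 = 0 by have := f_lin (-1) 0 0; rewrite scaler0 addr0 scaleN1r addNr.
have fZ c u : f (c *: u) = c *: f u by have := f_lin c u 0; rewrite !addr0 f0 addr0.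
have fD u v : f (u + v) = f u + f v by have := f_lin 1 u v; rewrite !scale1r.
have fN u : f (- u) = - f u by rewrite -!scaleN1r fZ.
have f_inj0 u : u != 0 -> f u != 0.
  by move=> u0; apply: contraNneq u0 => fu; rewrite -(fK u) fu -f0 fK.
have gr : good_reduction O h integral_elt (f \o red).
  split=> //=.
  - by move=> x y ix iy; rewrite redB // fD fN.
  - by move=> x y ix iy; rewrite redM.
  - by move=> c x Oc ix; rewrite redZ // fZ.
  - by move=> y; have [x ix xE] := red_onto (g y); exists x => //; rewrite xE gK.
  - move=> x /co_neq0[i xi].
    (* Dividing by the dominant coordinate leaves all coordinates in O and one of them equal to 1,
       so the reduction is nonzero. *)
    have [m xm Om] := dominant_coordinate resO (f := fun i => co x 0 i) xi.
    exists (co x 0 m)^-1; rewrite invr_eq0; split=> //.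
      by move=> l; rewrite coZ mxE mulrC.
    apply: f_inj0; apply/eqP => /rowP/(_ m)/eqP.
    by rewrite !mxE coZ mxE mulVf // (res1 resO) oner_eq0.
  (* c is the i-th coordinate of the integral element (c 1) b_i; an index i exists because 1 is
     nonzero. *)
  - move=> c ic; have [i _] := co_neq0 1 (oner_neq0 _).
    have := intM ic (y := b i); rewrite mulr_algl => /(_ _ i).
    rewrite coZ co_b !mxE !eqxx mulr1; apply=> j; rewrite co_b mxE.
    by case: (_ && _); [exact: (res_in1 resO) | exact: (res_in0 resO)].
exists R, (f \o red); split=> //; last first.
  exists (fun i => f (delta_mx 0 i)), g; split=> // y.
  rewrite -[LHS]gK [g y in LHS]row_sum_delta.
  elim: (index_enum _) => [|i r IH]; first by rewrite !big_nil.
  by rewrite !big_cons fD fZ IH.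
move=> y z yz; have [x ix xE] := gr_onto gr y.
have [y0|y0] := eqVneq y 0; [by left | right].
have [j yj] : exists j, red x 0 j != 0.
  apply: contrapT => no_j; move/eqP: y0; apply; rewrite -xE /= -f0; congr f.
  apply/rowP => j; rewrite [RHS]mxE; apply/eqP; apply: contrapT => /negP ?.
  by apply: no_j; exists j.
have opE : h (co x 0 j) *: 1 = \sum_(t <- S j) f (red t.1) * y * f (red t.2).
  have <- : f (red (co x 0 j)%:A) = h (co x 0 j) *: 1.
    by rewrite redZ // fZ f1.
  rewrite -SP /elementary_op.
  suff : integral_elt (\sum_(t <- S j) t.1 * x * t.2) /\
     f (red (\sum_(t <- S j) t.1 * x * t.2)) = \sum_(t <- S j) f (red t.1) * y * f (red t.2) by case.
  have intT t : t \in S j -> integral_elt (t.1 * x * t.2).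
    by move=> /intS[? ?]; apply: intM => //; exact: intM.
  rewrite !(@big_seq _ _ _ _ (S j)).
  elim/big_rec2: _ => [|t u v tS [iv IH]].
    by split=> //; rewrite -f0; congr f; apply/rowP => i; rewrite !mxE co0 mxE (res0 resO).
  split; first by apply: intD => //; exact: intT.
  have [i1 i2] := intS tS.
  by rewrite redD ?fD ?IH; [| exact: intT | ]; rewrite // !redM ?fM -?xE //; exact: intM.
have : (h (co x 0 j) *: 1) * z = 0.
  rewrite opE mulr_suml big1 // => t _; rewrite -!mulrA.
  by rewrite (mulrA y) yz mulr0.
rewrite mulr_algl => /eqP; rewrite scaler_eq0 => /orP[|/eqP //].
by move: yj; rewrite mxE => /negPf ->.
Qed.

End Reduction.

(** * Division subrings as algebras over their centre *)

Section Basis.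
Variables (F : fieldType) (V : lmodType F).

(** A spanning family of least size is free, since a nontrivial relation would allow one vector to
    be dropped. *)
Lemma basis_of_spanning m (e : 'I_m -> V) :
  (forall x, exists c : 'I_m -> F, x = \sum_i c i *: e i) ->
  exists n (b : 'I_n -> V) (co : V -> 'rV[F]_n), [/\ linear co,
    forall x, x = \sum_i co x 0 i *: b i & forall i, co (b i) = delta_mx 0 i].
Proof.
move=> span_e.
pose spanning n := `[< exists b : 'I_n -> V,
  forall x, exists c : 'I_n -> F, x = \sum_i c i *: b i >].
have ex : exists n, spanning n by exists m; apply/asboolP; exists e.
case: (ex_minnP ex) => n /asboolP[b span_b] min_n.
have free_b (c : 'I_n -> F) : \sum_i c i *: b i = 0 -> forall i, c i = 0.
  move=> cb j; apply/eqP; apply: contraT => cj; exfalso.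
  case: n b span_b min_n c cb j cj => [|n] b span_b min_n c cb j cj; first by case: j cj.
  have := min_n n; rewrite ltnn => /(_ _)/negP; apply=> //.
  apply/asboolP; exists (fun i => b (lift j i)) => x; have [d xE] := span_b x.
  have bj : b j = - \sum_i (c (lift j i) / c j) *: b (lift j i).
    apply: (scalerI cj); rewrite scalerN scaler_sumr.
    move: cb; rewrite (bigD1_ord j) //= => /eqP; rewrite addr_eq0 => /eqP ->; congr (- _).
    by apply: eq_bigr => i _; rewrite scalerA mulrC divfK.
  exists (fun i => d (lift j i) - d j * (c (lift j i) / c j)).
  rewrite xE (bigD1_ord j) //= {1}bj scalerN scaler_sumr addrC -sumrB.
  by apply: eq_bigr => i _; rewrite scalerA scalerBl.
have [co0 co0P] := boolp.choice span_b.
pose co x := \row_i co0 x i.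
have coP x : x = \sum_i co x 0 i *: b i.
  by rewrite {1}[x]co0P; apply: eq_bigr => i _; rewrite mxE.
have coU x (c : 'rV_n) : x = \sum_i c 0 i *: b i -> co x = c.
  move=> xE; apply/rowP => i; apply/eqP; rewrite -subr_eq0; apply/eqP.
  apply: (free_b (fun i => co x 0 i - c 0 i)).
  by under eq_bigr do rewrite scalerBl; rewrite sumrB -coP -xE subrr.
exists n, b, co; split=> // [a x y|i]; apply: coU.
  rewrite {1}[x]coP {1}[y]coP scaler_sumr -big_split; apply: eq_bigr => i _ /=.
  by rewrite !mxE scalerDl scalerA.
rewrite (bigD1 i) //= mxE !eqxx scale1r big1 ?addr0 // => j ji.
by rewrite mxE (negPf ji) andbF scale0r.
Qed.

End Basis.

Section DivisionSubring.
Variables (D : unitRingType) (P : D -> Prop).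
Hypothesis divD : is_division_ring D.
Hypothesis subP : is_divsubring P.

Definition division_subring_pred : {pred D} := fun x => `[< P x >].
Local Notation S := division_subring_pred.

Let S_divring : divring_closed S.
Proof.
have [P0 P1 PB PM PV] := subP; split; first exact/asboolP.
  by move=> x y /asboolP Px /asboolP Py; apply/asboolP; exact: PB.
move=> x y /asboolP Px /asboolP Py; apply/asboolP; apply: PM => //.
by have [->|/PV] := eqVneq y 0; [rewrite invr0 | apply].
Qed.

HB.instance Definition _ := GRing.isDivringClosed.Build D S S_divring.

Definition division_subring := {x : D | S x}.
HB.instance Definition _ := SubChoice.on division_subring.
HB.instance Definition _ := [SubChoice_isSubUnitRing of division_subring by <:].

Lemma division_subring_exists : exists (K : unitRingType) (f : {rmorphism K -> D}),
  [/\ is_division_ring K, injective f & forall x, P x <-> exists u, f u = x].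
Proof.
exists division_subring, (val : division_subring -> D); split.
- move=> x x0.
  have /divD Ux : val x != 0 by rewrite -(rmorph0 (val : division_subring -> D)) (inj_eq val_inj).
  by apply/unitrP; exists x^-1; split; apply: val_inj; rewrite rmorphM /= ?mulVr ?mulrV.
- exact: val_inj.
- move=> x; split=> [Px|[u <-]]; last exact/asboolP/(valP u).
  have Sx : S x by exact/asboolP.
  by exists (exist _ x Sx : division_subring).
Qed.

End DivisionSubring.

Section Center.
Variable K : unitRingType.
Hypothesis divK : is_division_ring K.

Definition center_pred : {pred K} := fun x => `[< central x >].

Let center_divring : divring_closed center_pred.
Proof.
split; first by apply/asboolP => y; rewrite mul1r mulr1.
  move=> x y /asboolP cx /asboolP cy; apply/asboolP => z.
  by rewrite mulrBl mulrBr cx cy.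
move=> x y /asboolP cx /asboolP cy; apply/asboolP => z.
have cyV : z * y^-1 = y^-1 * z by apply: commrV => //; rewrite /GRing.comm cy.
by rewrite -mulrA -cyV mulrA cx mulrA.
Qed.

HB.instance Definition _ := GRing.isDivringClosed.Build K center_pred center_divring.

Definition center_field := {x : K | center_pred x}.
HB.instance Definition _ := SubChoice.on center_field.
HB.instance Definition _ := [SubChoice_isSubUnitRing of center_field by <:].

Let center_mulC : commutative (@GRing.mul center_field).
Proof. by move=> x y; apply: val_inj; exact: (asboolW (valP x)). Qed.

HB.instance Definition _ := GRing.PzRing_hasCommutativeMul.Build center_field center_mulC.

Let center_fieldP : GRing.field_axiom center_field.
Proof.
move=> x x0.
have /divK Ux : val x != 0 by rewrite -(rmorph0 (val : center_field -> K)) (inj_eq val_inj).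
by apply/unitrP; exists x^-1; split; apply: val_inj; rewrite rmorphM /= ?mulVr ?mulrV.
Qed.

HB.instance Definition _ := GRing.ComUnitRing_isField.Build center_field center_fieldP.

Lemma center_field_exists : exists (F : fieldType) (f : {rmorphism F -> K}),
  forall x, central x <-> exists c, f c = x.
Proof.
exists center_field, (val : center_field -> K) => x.
split=> [cx|[c <-]]; last exact/asboolP/(valP c).
have Zx : center_pred x by exact/asboolP.
by exists (exist _ x Zx : center_field).
Qed.

End Center.

Section CentralAlgebra.
Variables (F : fieldType) (K : nzRingType) (f : {rmorphism F -> K}).
Hypothesis f_central : forall c x, f c * x = x * f c.

Definition central_algebra := (K : Type).
HB.instance Definition _ := GRing.NzRing.on central_algebra.

Let scale (c : F) (x : central_algebra) : central_algebra := f c * x.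

HB.instance Definition _ := @GRing.Zmodule_isLmodule.Build F central_algebra scale
  (fun c d x => etrans (mulrA _ _ _) (congr1 ( *%R^~ x) (esym (rmorphM f c d))))
  (fun x => etrans (congr1 ( *%R^~ x) (rmorph1 f)) (mul1r x))
  (fun c x y => mulrDr _ _ _)
  (fun x c d => etrans (congr1 ( *%R^~ x) (rmorphD f c d)) (mulrDl _ _ _)).
HB.instance Definition _ := @GRing.Lmodule_isLalgebra.Build F central_algebra
  (fun c x y => mulrA _ _ _).

Let scaleAr (c : F) (x y : central_algebra) : c *: (x * y) = x * (c *: y).
Proof. by rewrite /GRing.scale /= /scale mulrA f_central -mulrA. Qed.

HB.instance Definition _ := GRing.Lalgebra_isAlgebra.Build F central_algebra scaleAr.

Lemma central_algebra_exists : exists (A : algType F) (g : {rmorphism A -> K}),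
  bijective g /\ forall c x, g (c *: x) = f c * g x.
Proof.
exists central_algebra, (idfun : {rmorphism central_algebra -> central_algebra}).
by split=> //; exists id.
Qed.

End CentralAlgebra.

(** * Ping-pong *)

(* T x y: some nonzero central multiple of x reduces to y. The reductions of a
   and a^-1 are m and m'; x true and x false are inverse to each other. *)
Record pingpong (D : unitRingType) (R : nzRingType) (T : D -> R -> Prop)
    (a : D) (m m' : R) (eps : bool -> R) (x : bool -> D) (y : bool -> R) : Prop :=
  Pingpong {
    ppM : forall u v z w, T u z -> T v w -> T (u * v) (z * w);
    pp1 : forall z, T 1 z -> z != 0 -> exists w, z * w = 1;
    pp_a : T a m;
    pp_aV : T a^-1 m';
    pp_mV : m * m' = 1;
    pp_Vm : m' * m = 1;
    pp_idem : forall i, eps i * eps i = eps i;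
    pp_neq0 : forall i, eps i != 0;
    pp_orth : forall i, eps i * eps (~~ i) = 0;
    pp_cancel : forall i z w, z != 0 -> w != 0 -> z * eps i = z -> eps i * w = w ->
      z * w != 0;
    pp_meps : forall i j, eps i * m * eps j != 0;
    pp_m'eps : forall i j, eps i * m' * eps j != 0;
    pp_x : forall i, T (x i) (y i);
    pp_y : forall i, [/\ y i != 0, eps i * y i = y i & y i * eps i = y i];
    pp_unit_a : a \is a GRing.unit;
    pp_unit_x : forall i, x i \is a GRing.unit;
    pp_xV : forall i, (x i)^-1 = x (~~ i) }.

Section Pingpong.
Variables (D : unitRingType) (R : nzRingType) (T : D -> R -> Prop).
Variables (a : D) (m m' : R) (eps : bool -> R) (x : bool -> D) (y : bool -> R).
Hypothesis pp : pingpong T a m m' eps x y.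

Definition corner i j (z : R) : Prop := [/\ z != 0, eps i * z = z & z * eps j = z].

Lemma corner_mul i j i' j' z c w : corner i j z -> corner i' j' w ->
  eps j * c * eps i' != 0 -> corner i j' (z * c * w).
Proof.
move=> [z0 iz zj] [w0 iw wj] c0; split.
- have -> : z * c * w = z * (eps j * c * eps i' * w) by rewrite !mulrA zj -(mulrA _ (eps i')) iw.
  have ie : eps j * (eps j * c * eps i' * w) = eps j * c * eps i' * w.
    by rewrite !mulrA (pp_idem pp).
  apply: (pp_cancel pp z0 _ zj ie); apply: (pp_cancel pp c0 w0 _ iw).
  by rewrite -(mulrA _ (eps i')) (pp_idem pp).
- by rewrite !mulrA iz.
- by rewrite -!mulrA wj.
Qed.

Lemma corner_mul_m i j i' j' z w : corner i j z -> corner i' j' w ->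
  corner i j' (z * m * w).
Proof. by move=> cz cw; apply: corner_mul cz cw _; exact: (pp_meps pp). Qed.

Lemma corner_mul_m' i j i' j' z w : corner i j z -> corner i' j' w ->
  corner i j' (z * m' * w).
Proof. by move=> cz cw; apply: corner_mul cz cw _; exact: (pp_m'eps pp). Qed.

Lemma corner_mul1 i j j' z w : corner i j z -> corner j j' w -> corner i j' (z * w).
Proof.
move=> cz cw; rewrite -[z]mulr1; apply: corner_mul cz cw _.
by rewrite mulr1 (pp_idem pp) (pp_neq0 pp).
Qed.

(** m' stands on the outer left for g and m on the outer right for g^-1. Hence exactly one of m, m'
    stands between two adjacent letters of equal sign, and between letters of opposite sign none is
    left. *)
Definition hyperbolic i (g : D) : Prop :=
  g \is a GRing.unit /\ exists z z', [/\ corner (~~ i) i z, corner (~~ i) i z',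
    T g (m' * z) & T g^-1 (z' * m)].

Let unit_a := pp_unit_a pp.

(** The commutator [a, g], bracketed as a^-1 times a conjugate of a: a normal subgroup containing a
    contains it. *)
Definition comm_a (g : D) : D := a^-1 * (g^-1 * a * g).

Let comm_aV g : g \is a GRing.unit -> (comm_a g)^-1 = g^-1 * a^-1 * g * a.
Proof.
move=> Ug; have Ua := unit_a.
have UgV : g^-1 \is a GRing.unit by rewrite unitrV.
have UaV : a^-1 \is a GRing.unit by rewrite unitrV.
have Uga : g^-1 * a \is a GRing.unit by rewrite unitrMl.
have Ugag : g^-1 * a * g \is a GRing.unit by rewrite unitrMl.
rewrite /comm_a invrM // invrK (invrM Uga) // (invrM UgV) // invrK.
by rewrite !mulrA.
Qed.

Let unit_comm_a g : g \is a GRing.unit -> comm_a g \is a GRing.unit.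
Proof.
by move=> Ug; have Ua := unit_a; rewrite /comm_a unitrMl ?unitrV // !unitrMl // unitrV.
Qed.

Lemma hyperbolic_base i : hyperbolic i (comm_a (x i)).
Proof.
have Ux := pp_unit_x pp i; split; first exact: unit_comm_a.
have cy j : corner j j (y j) by have [] := pp_y pp j.
have TxV : T (x i)^-1 (y (~~ i)) by rewrite (pp_xV pp); exact: (pp_x pp).
exists (y (~~ i) * m * y i), (y (~~ i) * m' * y i); split.
- exact: corner_mul_m (cy _) (cy _).
- exact: corner_mul_m' (cy _) (cy _).
- apply: (ppM pp (pp_aV pp)); apply: (ppM pp) (pp_x pp i).
  exact: (ppM pp TxV (pp_a pp)).
- rewrite comm_aV //; apply: (ppM pp) (pp_a pp); apply: (ppM pp) (pp_x pp i).
  exact: (ppM pp TxV (pp_aV pp)).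
Qed.

(** The outer factors cancel against the inserted a or a^-1: (z' m) m (m' z) = z' m z and (z' m) m'
    (m' z) = z' m' z, both again in the required corner. *)
Lemma hyperbolic_comm i g : hyperbolic i g -> hyperbolic i (comm_a g).
Proof.
move=> [Ug [z [z' [cz cz' Tg TgV]]]]; split; first exact: unit_comm_a.
exists (z' * m * z), (z' * m' * z); split.
- exact: corner_mul_m cz' cz.
- exact: corner_mul_m' cz' cz.
- apply: (ppM pp (pp_aV pp)).
  have -> : z' * m * z = z' * m * m * (m' * z) by rewrite -!mulrA (mulrA m m') (pp_mV pp) mul1r.
  by apply: (ppM pp) Tg; exact: (ppM pp TgV (pp_a pp)).
- rewrite comm_aV //; apply: (ppM pp) (pp_a pp).
  have -> : z' * m' * z = z' * m * m' * (m' * z) by rewrite -(mulrA z' m) (pp_mV pp) mulr1 mulrA.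
  by apply: (ppM pp) Tg; exact: (ppM pp TgV (pp_aV pp)).
Qed.

Lemma hyperbolic_exp i g n : hyperbolic i g -> hyperbolic i (g ^+ n.+1).
Proof.
move=> [Ug [z [z' [cz cz' Tg TgV]]]]; split; first exact: unitrX.
elim: n => [|n [w [w' [cw cw' Tw TwV]]]]; first by exists z, z'; rewrite expr1.
exists (z * m' * w), (w' * m * z'); split.
- exact: corner_mul_m' cz cw.
- exact: corner_mul_m cw' cz'.
- by rewrite exprS -!mulrA (mulrA m' z); exact: (ppM pp).
- rewrite exprS invrM ?unitrX // -(mulrA _ z'); exact: (ppM pp).
Qed.

(** Among the powers with exponents 0 to |s|, two lie in the same coset of B, and their quotient is
    a positive power of g. *)
Lemma finite_index_exp (A B : D -> Prop) g : finite_index_in B A ->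
  (forall u, A u -> u \is a GRing.unit) -> (forall n, A (g ^+ n)) ->
  (forall u v, B u -> B v -> B (u * v)) -> (forall u, B u -> B u^-1) ->
  exists n, B (g ^+ n.+1).
Proof.
move=> [s [sA As]] unitA Ag BM BV.
have ex n : exists t, t \in s /\ B (g ^+ n * t^-1) by have [t ts Bt] := As _ (Ag n); exists t.
have [t tP] := boolp.choice ex.
have ind n : (index (t n) s < size s)%N by rewrite index_mem; case: (tP n).
pose f (i : 'I_(size s).+1) : 'I_(size s) := Ordinal (ind i).
have /injectivePn[i [j ij fij]] : ~~ injectiveb f.
  by apply/injectiveP => /leq_card; rewrite !card_ord ltnn.
have tij : t i = t j.
  move/(congr1 (fun i => nth 0 s (val i))): fij => /=.
  by rewrite !nth_index //; case: (tP i); case: (tP j).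
have {ij fij} : (i < j)%N \/ (j < i)%N by apply/orP; rewrite -neq_ltn.
move: (nat_of_ord i) (nat_of_ord j) tij => {}i {}j tij.
wlog ij : i j tij / (i < j)%N => [wl [] ij|_].
- by apply: (wl i j) => //; left.
- by apply: (wl j i) => //; left.
have Ut : t i \is a GRing.unit by apply: unitA; apply: sA; case: (tP i).
have Ug : g ^+ i \is a GRing.unit by exact: unitA.
exists (j - i.+1)%N; rewrite -subSn //= subSS.
have -> : g ^+ (j - i) = (g ^+ j * (t j)^-1) * (g ^+ i * (t i)^-1)^-1.
  rewrite invrM ?unitrV // invrK mulrA -tij mulrVK // -[in RHS](subnK (ltnW ij)) exprD.
  by rewrite mulrK.
by apply: BM; [case: (tP j) | apply: BV; case: (tP i)].
Qed.

Lemma hyperbolic_subnormal i (H : D -> Prop) : H a -> is_division_ring D ->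
  almost_subnormal H -> exists2 g, H g & hyperbolic i g.
Proof.
move=> Ha divD [r [c [c0 cr cS]]].
have grp j : (j <= r)%N -> [/\ forall u, c j u -> u \is a GRing.unit, c j 1 &
    forall u v, c j u -> c j v -> c j (u * v)].
  elim: j => [|j IH] jr; first split.
  - by move=> u /c0.
  - by apply/c0; exact: unitr1.
  - by move=> u v /c0 Uu /c0 Uv; apply/c0; rewrite /unitgroup unitrMl.
  have [Uc _ _] := IH (ltnW jr); have [[sub c1 cM cV] _] := cS j jr.
  by split=> // u /sub; exact: Uc.
(* [a] lies in the last term of a decreasing chain, hence in all of them; the induction is on the
   distance from the bottom. *)
have ca' d : (d <= r)%N -> c (r - d)%N a.
  elim: d => [_|d IH dr]; first by rewrite subn0; apply/cr.
  have dr' : (r - d.+1 < r)%N by rewrite ltn_subrL /= (leq_ltn_trans _ dr).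
  have [[sub _ _ _] _] := cS _ dr'; apply: sub.
  by rewrite subnSK //; apply: IH; exact: ltnW.
have ca j : (j <= r)%N -> c j a by move=> jr; rewrite -(subKn jr); exact/ca'/leq_subr.
suff hj j : (j <= r)%N -> exists2 g, c j g & hyperbolic i g.
  by have [g /cr Hg hg] := hj r (leqnn r); exists g.
elim: j => [|j IH] jr.
  by exists (comm_a (x i)); [apply/c0; exact: unit_comm_a (pp_unit_x pp i) | exact: hyperbolic_base].
have [g cg hg] := IH (ltnW jr).
have [[_ c1 cM cV] step] := cS j jr; have [unitc c1' cM'] := grp j (ltnW jr).
case: step => [nc|fc].
  exists (comm_a g); last exact: hyperbolic_comm.
  by apply: cM; [apply: cV; exact: ca | apply: nc => //; exact: ca].
have [|n gn] := finite_index_exp fc unitc _ cM cV (g := g).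
  by elim=> [|n IHn]; rewrite ?expr0 // exprS; exact: cM'.
by exists (g ^+ n.+1) => //; exact: hyperbolic_exp.
Qed.

(** Outer factors of the reduction of a letter, where [v] = true marks an inverse: m' z for a
    generator, z' m for its inverse. [lfV] and [rfV] undo them. *)
Let lf v := if v then 1 else m'.
Let rf v := if v then m else 1.
Let lfV v := if v then 1 else m.
Let rfV v := if v then m' else 1.

Let lfK v : lfV v * lf v = 1.
Proof. by case: v; rewrite /lfV /lf ?mulr1 // (pp_mV pp). Qed.
Let rfK v : rf v * rfV v = 1.
Proof. by case: v; rewrite /rfV /rf ?mulr1 // (pp_mV pp). Qed.

(** By [pp1] a nonzero reduction of 1 has a right inverse, whereas z = [eps i] z is killed on the
    left by the nonzero [eps (~~ i)]. *)
Lemma ping_neq1 i j v v' z : corner i j z -> ~ T 1 (lf v * z * rf v').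
Proof.
move=> [z0 iz zj] T1.
have [|w zw] := pp1 pp T1.
  apply: contraNneq z0 => h.
  have <- : lfV v * (lf v * z * rf v') * rfV v' = z.
    by rewrite !mulrA lfK mul1r -mulrA rfK mulr1.
  by rewrite h mulr0 mul0r.
have zE : z * rf v' * w = lfV v by rewrite -[RHS]mulr1 -zw !mulrA lfK mul1r.
have : eps (~~ i) * lfV v = 0.
  have := pp_orth pp (~~ i); rewrite negbK => oi.
  by rewrite -zE !mulrA -iz !mulrA oi !mul0r.
move/(congr1 ( *%R^~ (lfV v * lf v))); rewrite lfK mulr1 mul0r => h.
have := pp_neq0 pp (~~ i); rewrite -[eps _]mulr1.
have <- : lfV v * lf v = 1 by exact: lfK.
by rewrite mulrA h mul0r eqxx.
Qed.

Lemma pingpong_free (H : D -> Prop) g1 g2 :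
  H g1 -> H g2 -> hyperbolic true g1 -> hyperbolic false g2 -> contains_noncyclic_free H.
Proof.
move=> Hg1 Hg2 h1 h2.
have [U1 [z1 [z1' [c1 c1' T1 T1V]]]] := h1.
have [U2 [z2 [z2' [c2 c2' T2 T2V]]]] := h2.
(* If they were equal, 1 = g1 g2^-1 would reduce to m' z1 z2' m, with z1 z2' nonzero in the corner
   of [eps false]. *)
have g12 : g1 != g2.
  apply/eqP => g12; rewrite -g12 in T2V.
  apply: (@ping_neq1 false false false true (z1 * z2')).
    exact: corner_mul1 c1 c2'.
  by rewrite -(divrr U1) /= !mulrA -[_ * m]mulrA; exact: (ppM pp).
pose t (l : D * bool) := l.1 == g1.
have letter (l : D * bool) : l.1 = g1 \/ l.1 = g2 -> exists z, corner (~~ t l) (t l) z /\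
    T (if l.2 then l.1^-1 else l.1) (lf l.2 * z * rf l.2).
  rewrite /t; case: l => g [] /= [->|->]; rewrite ?eqxx ?[g2 == g1]eq_sym ?(negPf g12) /=.
  - by exists z1'; rewrite /lf /rf mul1r.
  - by exists z2'; rewrite /lf /rf mul1r.
  - by exists z1; rewrite /lf /rf mulr1.
  - by exists z2; rewrite /lf /rf mulr1.
(* For equal signs m or m' stands at the junction, and all its entries are nonzero. For opposite
   signs the corners meet directly, and their product survives exactly because a reduced word has
   different generators there. *)
have ping w : forall l, reduced_word (l :: w) ->
    (forall l', l' \in l :: w -> l'.1 = g1 \/ l'.1 = g2) ->
    exists z, corner (~~ t l) (t (last l w)) z /\
      T (eval_word (l :: w)) (lf l.2 * z * rf (last l w).2).
  elim: w => [|l' w IH] l red inX.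
    have [z [cz Tz]] := letter l (inX l (mem_head _ _)).
    by exists z; rewrite /eval_word big_seq1.
  have [z [cz Tz]] := letter l (inX l (mem_head _ _)).
  move: red => /= /andP[ll' red].
  have [|w' [cw Tw]] := IH l' red; first by move=> u uw; apply: inX; rewrite inE uw orbT.
  exists (z * (rf l.2 * lf l'.2) * w'); split; last first.
    rewrite /eval_word big_cons; have := ppM pp Tz Tw; rewrite /eval_word !mulrA; exact.
  have tl := inX l (mem_head _ _).
  have tl' : l'.1 = g1 \/ l'.1 = g2 by apply: inX; rewrite inE mem_head orbT.
  apply: corner_mul cz cw _.
  have [v12|v12] := eqVneq l.2 l'.2.
    rewrite v12 /lf /rf; case: l'.2; rewrite ?mulr1 ?mul1r; [exact: (pp_meps pp)|exact: (pp_m'eps pp)].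
  have tt' : ~~ t l' = t l.
    rewrite v12 andbT in ll'; rewrite /t; move: tl tl' ll'.
    by case=> -> [] ->; rewrite ?eqxx ?[g2 == g1]eq_sym ?(negPf g12).
  rewrite tt'.
  have -> : rf l.2 * lf l'.2 = 1.
    by move: v12; case: l.2; case: l'.2 => //= _; rewrite /rf /lf ?mulr1 // (pp_mV pp).
  by rewrite mulr1 (pp_idem pp) (pp_neq0 pp).
exists (fun g => g = g1 \/ g = g2); split.
- by move=> g [->|->].
- by exists g1, g2; split=> //; [left | right].
- case=> // l w _ red inX; apply/eqP => w1.
  have [z [cz]] := ping w l red inX; rewrite w1; exact: (ping_neq1 cz).
Qed.

End Pingpong.

(** * Centrally finite division rings *)

Lemma infinite_uniq_seq (T : eqType) n : (forall s : seq T, exists x, x \notin s) ->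
  exists2 s : seq T, uniq s & size s = n.
Proof.
move=> infT; elim: n => [|n [s us sn]]; first by exists [::].
by have [x xs] := infT s; exists (x :: s); rewrite /= ?xs ?us ?sn.
Qed.

Section CentrallyFinite.
Variables (F : fieldType) (K : algType F) (n : nat) (b : 'I_n -> K).
Variable co : K -> 'rV[F]_n.
Hypothesis co_lin : linear co.
Hypothesis co_sum : forall x, x = \sum_i co x 0 i *: b i.
Hypothesis co_b : forall i, co (b i) = delta_mx 0 i.
Hypothesis divK : forall x : K, x != 0 -> exists2 y, x * y = 1 & y * x = 1.
Hypothesis centerK : forall x : K, (forall y, x * y = y * x) -> exists c, x = c%:A.
Variables (a c : K).
Hypothesis ac : a * c != c * a.

(** With a finite centre K would be finite, hence commutative by Wedderburn's theorem. *)
Lemma center_infinite (s : seq F) : exists x, x \notin s.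
Proof.
apply: contrapT => no_x; have all_s x : x \in s.
  by apply: contraT => xs; case: no_x; exists x.
move/eqP: ac; apply; apply: (finite_scalars_mulrC co_sum (k0 := s)) =>
  [|? ? _ _|? ? _ _|i j l|l|l|l|u v uv]; rewrite ?all_s //.
have [//|u0] := eqVneq u 0.
have [w _ wu] := divK u0.
by rewrite /= -[v]mul1r -wu -mulrA uv mulr0.
Qed.

Lemma integral_reduction (X : seq K) N : exists (p : nat) (k : fieldType) (O : F -> Prop)
    (h : F -> k) (R : algType k) (pi : K -> R),
  [/\ algebraic_over_Fp p k, good_reduction O h (integral_elt O co) pi /\ prime_ring R,
    exists (b' : 'I_n -> R) (co' : R -> 'rV[k]_n), linear co' /\
      forall y, y = \sum_i co' y 0 i *: b' i,
    forall x, x \in X -> integral_elt O co x &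
    exists2 s : seq k, uniq s & size s = N].
Proof.
have [S SP] := coordinate_ops co_lin co_sum co_b divK centerK.
have [s us sN] := infinite_uniq_seq N center_infinite.
pose entries x := [seq co x 0 l | l : 'I_n].
(* Integrality of these elements makes the lattice a subring, contains the coordinate operators in
   it, and covers the requested [X]. *)
pose Y := 1 :: [seq b i * b j | i <- enum 'I_n, j <- enum 'I_n] ++
  flatten [seq flatten [seq [:: t.1; t.2] | t <- S j] | j <- enum 'I_n] ++ X.
(* The differences of elements of [s] become units so that their residues stay distinct; otherwise k
   could be too small. *)
pose coeffs := s ++ [seq u - v | u <- s, v <- s] ++ flatten [seq entries x | x <- Y].
have [|p [k [O [h [algk resO unitO]]]]] := @exists_residue_map F [seq u <- coeffs | u != 0].
  by rewrite mem_filter eqxx.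
have inO u : u \in coeffs -> O u.
  move=> uc; have [->|u0] := eqVneq u 0; first exact: (res_in0 resO).
  by have [|//] := unitO u; rewrite mem_filter u0.
have intY x : x \in Y -> integral_elt O co x.
  move=> xY l; apply: inO; rewrite 2!mem_cat; apply/orP; right; apply/orP; right.
  by apply/flatten_mapP; exists x => //; apply: map_f; rewrite mem_enum.
have [|||R [pi [gr primeR basisR]]] := good_reduction_exists resO co_lin co_sum co_b SP.
- by apply: intY; rewrite inE eqxx.
- move=> i j; apply: intY; rewrite inE mem_cat; apply/orP; right; apply/orP; left.
  by apply/allpairsP; exists (i, j); rewrite !mem_enum.
- move=> j t tS.
  suff tY x : x \in [:: t.1; t.2] -> integral_elt O co x.
    by split; apply: tY; rewrite !inE eqxx ?orbT.
  move=> xt; apply: intY; rewrite inE !mem_cat; apply/orP; right; apply/orP; right.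
  apply/orP; left; apply/flatten_mapP; exists j; rewrite ?mem_enum //.
  by apply/flatten_mapP; exists t.
exists p, k, O, h, R, pi; split=> //.
- by move=> x xX; apply: intY; rewrite inE !mem_cat xX !orbT.
- exists [seq h u | u <- s]; last by rewrite size_map.
  rewrite map_inj_in_uniq // => u v us' vs' huv; apply/eqP; rewrite -subr_eq0.
  apply: contraT => uv0; have [] := unitO (u - v).
    rewrite mem_filter uv0 2!mem_cat; apply/orP; right; apply/orP; left.
    by apply/allpairsP; exists (u, v).
  have sO w : w \in s -> O w by move=> ws; apply: inO; rewrite mem_cat ws.
  by rewrite (resB resO) ?huv ?subrr ?eqxx //; exact: sO.
Qed.

Lemma pingpong_exists (D : unitRingType) (iota : {rmorphism K -> D}) : injective iota ->
  exists (R : nzRingType) (T : D -> R -> Prop) (m m' : R) (eps : bool -> R)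
    (x : bool -> D) (y : bool -> R), pingpong T (iota a) m m' eps x y.
Proof.
move=> iota_inj.
have a0 : a != 0 by apply: contraNneq ac => ->; rewrite mul0r mulr0.
have [a' aa' a'a] := divK a0.
have [w acw _] : exists2 w, (a * c - c * a) * w = 1 & w * (a * c - c * a) = 1.
  by apply: divK; rewrite subr_eq0.
(* An integral inverse w of ac - ca keeps this commutator nonzero in R. 17 is the least number of
   scalars exceeding the 16 possible roots. *)
have [p [k [O [h [R [pi [algk [gr primeR] [b' [co' [co'_lin co'_sum]]] intX [s us sN]]]]]]]] :=
  integral_reduction [:: a; a'; c; w] 17.
set L := integral_elt O co in gr intX.
have La : L a by apply: intX; rewrite !inE eqxx.
have La' : L a' by apply: intX; rewrite !inE eqxx ?orbT.
have Lc : L c by apply: intX; rewrite !inE eqxx ?orbT.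
have Lw : L w by apply: intX; rewrite !inE eqxx ?orbT.
have piaa' : pi a * pi a' = 1 by rewrite -(grM gr) // aa' (gr1 gr).
have pia'a : pi a' * pi a = 1 by rewrite -(grM gr) // a'a (gr1 gr).
have piac : pi a * pi c != pi c * pi a.
  have := gr1 gr; rewrite -acw (grM gr) //; last first.
    by apply: (gr_inB gr); apply: (gr_inM gr).
  rewrite (grB gr) ?(grM gr) //; try exact: (gr_inM gr).
  move=> h1; rewrite -subr_eq0; apply: contraTneq isT => h0.
  by move: h1; rewrite h0 mul0r => /esym/eqP; rewrite oner_eq0.
have zd : exists u v : R, [/\ u != 0, v != 0 & u * v = 0].
  apply: contrapT => no_zd; move/eqP: piac; apply.
  apply: (algebraic_domain_mulrC co'_sum algk) => u v uv.
  by apply: contraT; rewrite negb_or => /andP[u0 v0]; case: no_zd; exists u, v.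
have nca : ~ (forall v, pi a * v = v * pi a).
  by move=> ca; move/eqP: piac; apply; exact: ca.
have s16 : (16 < size s)%N by rewrite sN.
have [eps [pe oe ea ea']] := moved_idempotents primeR
  (minimal_right_exists co'_sum co'_lin) zd piaa' pia'a nca us s16.
have ee i : eps i * eps i = eps i by case: (pe i).
have e0 i : eps i != 0 by case: (pe i) => _ [].
(* The inverse of a lift of 1 - e, rescaled, reduces into the corner e R e. *)
have lift i : exists u u' d z, [/\ u * u' = 1, u' * u = 1, L u & pi u = 1 - eps i] /\
    [/\ d != 0, L (d *: u'), pi (d *: u') = z, z != 0 & eps i * z = z /\ z * eps i = z].
  have [u Lu piu] := gr_onto gr (1 - eps i).
  have pi0 : pi 0 = 0.
    by have := grB gr (gr_in1 gr) (gr_in1 gr); rewrite !subrr.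
  have u0 : u != 0.
    apply: contraNneq (e0 (~~ i)) => u0; move: piu; rewrite u0 pi0 => /esym/eqP.
    by rewrite subr_eq0 => /eqP e1; have := oe i; rewrite -e1 mul1r => ->.
  have [u' uu' u'u] := divK u0.
  have u'0 : u' != 0.
    by apply: contraTneq isT => u'0; move: uu'; rewrite u'0 mulr0 => /esym/eqP; rewrite oner_eq0.
  have [d [d0 Ld pid]] := gr_scale gr u'0.
  have du : u * (d *: u') = d%:A by rewrite -scalerAr uu'.
  have du' : (d *: u') * u = d%:A by rewrite -scalerAl u'u.
  have Ldd : L d%:A by rewrite -du; exact: (gr_inM gr).
  have Od := gr_scalar gr Ldd.
  have pidd : pi d%:A = h d *: 1 by rewrite (grZ gr) ?(gr1 gr) //; exact: (gr_in1 gr).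
  (* Reducing u (d u') = d gives (1 - [eps i]) z = h(d), and [eps i] kills the left side. Once h(d)
     = 0, the equations (1 - [eps i]) z = 0 = z (1 - [eps i]) put z into the corner. *)
  have hd : h d = 0.
    have := grM gr Lu Ld; rewrite du pidd piu => /(congr1 (fun z => eps i * z)).
    rewrite mulrA mulrBr mulr1 ee subrr mul0r -scalerAr mulr1 => /eqP.
    by rewrite scaler_eq0 (negPf (e0 i)) orbF => /eqP.
  exists u, u', d, (pi (d *: u')); split=> //; split=> //; split; apply/eqP.
    have := grM gr Lu Ld; rewrite du pidd hd scale0r piu mulrBl mul1r => /esym/eqP.
    by rewrite subr_eq0 eq_sym.
  have := grM gr Ld Lu; rewrite du' pidd hd scale0r piu mulrBr mulr1 => /esym/eqP.
  by rewrite subr_eq0 eq_sym.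
have [u1 [u1' [d1 [z1 [[uu1 uu1' Lu1 piu1] [d10 Ld1 pid1 z10 [ez1 ze1]]]]]]] := lift true.
have [u2 [u2' [d2 [z2 [[uu2 uu2' Lu2 piu2] [d20 Ld2 pid2 z20 [ez2 ze2]]]]]]] := lift false.
pose T (x : D) (y : R) := exists v, iota v = x /\
  exists d, [/\ d != 0, L (d *: v) & pi (d *: v) = y].
(* By orthogonality 1 - [eps false], the reduction of u2, fixes z1 on the right, so x true reduces
   to z1; symmetrically its inverse x false reduces to z2. *)
pose x i := iota (if i then u1' * u2 else u2' * u1).
pose y i := if i then z1 else z2.
have xx i : x i * x (~~ i) = 1.
  rewrite /x -rmorphM; case: i => /=.
    by rewrite mulrA -(mulrA u1') uu2 mulr1 uu1' rmorph1.
  by rewrite mulrA -(mulrA u2') uu1 mulr1 uu2' rmorph1.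
have Ux i : x i \is a GRing.unit.
  by apply/unitrP; exists (x (~~ i)); split; [rewrite -{2}[i]negbK xx | rewrite xx].
have Ua : iota a \is a GRing.unit.
  by apply/unitrP; exists (iota a'); rewrite -!rmorphM a'a aa' rmorph1.
have iaV : (iota a)^-1 = iota a'.
  by apply: (mulrI Ua); rewrite divrr // -rmorphM aa' rmorph1.
exists R, T, (pi a), (pi a'), eps, x, y; split=> //.
- move=> _ _ _ _ [v [<- [d [d0 Lv <-]]]] [v' [<- [d' [d'0 Lv' <-]]]].
  exists (v * v'); split; first by rewrite rmorphM.
  have dv : (d * d') *: (v * v') = (d *: v) * (d' *: v').
    by rewrite -scalerAl -scalerAr scalerA.
  exists (d * d'); rewrite dv mulf_neq0 //; split=> //; first exact: (gr_inM gr).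
  exact: (grM gr).
- move=> z [v []]; rewrite -(rmorph1 iota) => /iota_inj -> [d [d0 Ld <-]].
  have Od := gr_scalar gr Ld; rewrite (grZ gr) ?(gr1 gr) //; last exact: (gr_in1 gr).
  move=> hd; exists ((h d)^-1 *: 1); rewrite -scalerAl mul1r scalerA mulfV ?scale1r //.
  by apply: contraNneq hd => ->; rewrite scale0r.
- by exists a; split=> //; exists 1; rewrite scale1r oner_neq0.
- by exists a'; split=> //; exists 1; rewrite scale1r oner_neq0.
- by move=> i z1' z2' ? ? ? ?; apply: (primitive_mul_neq0 primeR (pe i)).
- case; rewrite /x /y.
    exists (u1' * u2); split=> //; exists d1; rewrite scalerAl; split=> //.
      exact: (gr_inM gr).
    rewrite (grM gr) // pid1 piu2 mulrBr mulr1 -ze1 -mulrA (oe true) mulr0 subr0 //.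
  exists (u2' * u1); split=> //; exists d2; rewrite scalerAl; split=> //.
    exact: (gr_inM gr).
  by rewrite (grM gr) // pid2 piu1 mulrBr mulr1 -ze2 -mulrA (oe false) mulr0 subr0.
- by case.
- by move=> i; apply: (mulrI (Ux i)); rewrite divrr // xx.
Qed.

End CentrallyFinite.

Lemma gen_divring_divsubring (D : unitRingType) (s : seq D) : is_divsubring (gen_divring s).
Proof.
split.
- by move=> S [].
- by move=> S [].
- by move=> x y gx gy S hS sS; case: (hS) => _ _ + _ _; apply; [exact: gx | exact: gy].
- by move=> x y gx gy S hS sS; case: (hS) => _ _ _ + _; apply; [exact: gx | exact: gy].
- by move=> x gx x0 S hS sS; case: (hS) => _ _ _ _; apply=> //; exact: gx.
Qed.

(** The subring generated by a and c is made an algebra over its own centre, which may differ from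
    that of D: finite dimension is known over the former. *)
Lemma wlf_pingpong (D : unitRingType) (a c : D) : is_division_ring D ->
  weakly_locally_finite D -> a * c != c * a ->
  exists (R : nzRingType) (T : D -> R -> Prop) (m m' : R) (eps : bool -> R)
    (x : bool -> D) (y : bool -> R), pingpong T a m m' eps x y.
Proof.
move=> divD wlfD ac.
pose s := [:: a; c].
have [K [f [divK f_inj fP]]] := division_subring_exists divD (gen_divring_divsubring s).
have [F [j jP]] := center_field_exists divK.
have j_central z x : j z * x = x * j z by have /(_ x) := (jP (j z)).2 (ex_intro _ z erefl).
have [A [g [[g' gK g'K] gZ]]] := central_algebra_exists j_central.
have g_inj : injective g := can_inj gK.
have fg_inj : injective (f \o g) by exact: inj_comp.
have liftA x : gen_divring s x -> exists u : A, f (g u) = x.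
  by move=> /fP[u <-]; exists (g' u); rewrite g'K.
have [a0 a0E] : exists u : A, f (g u) = a by apply: liftA => S _; apply; rewrite inE eqxx.
have [c0 c0E] : exists u : A, f (g u) = c by apply: liftA => S _; apply; rewrite !inE eqxx orbT.
have [bb [bbs spanb]] := wlfD s.
have ex_e (i : 'I_(size bb)) : exists u : A, f (g u) = bb`_i.
  by apply: liftA; apply: bbs; exact: mem_nth.
have [e eE] := boolp.choice ex_e.
have [|n [b [co [co_lin co_sum co_b]]]] := @basis_of_spanning F A _ e.
  move=> x; have [|cs [sz_cs cs_center xE]] := spanb (f (g x)).
    by apply/fP; exists (g x).
  have ex_d (i : 'I_(size bb)) : exists d : F, f (j d) = cs`_i.
    have [csK cs_comm] : center_of (gen_divring s) cs`_i.
      by apply: cs_center; apply: mem_nth; rewrite sz_cs.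
    have /fP[u uE] := csK.
    have /jP[d dE] : central u.
      by move=> v; apply: f_inj; rewrite !rmorphM uE; apply: cs_comm; apply/fP; exists v.
    by exists d; rewrite dE.
  have [d dE] := boolp.choice ex_d; exists d; apply: fg_inj => /=.
  rewrite xE !rmorph_sum; apply: eq_bigr => i _.
  by rewrite gZ rmorphM dE eE.
rewrite -a0E; apply: (@pingpong_exists F A n b co co_lin co_sum co_b _ _ a0 c0 _ D (f \o g) fg_inj).
- move=> x x0; have gx0 : g x != 0 by rewrite -(rmorph0 g) (inj_eq g_inj).
  have Ux := divK _ gx0.
  exists (g' (g x)^-1); apply: g_inj; rewrite rmorphM g'K rmorph1.
    exact: divrr.
  exact: mulVr.
- move=> x xc; have /jP[d dE] : central (g x).
    by move=> v; rewrite -[v]g'K -!rmorphM xc.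
  by exists d; apply: g_inj; rewrite gZ dE rmorph1 mulr1.
- apply: contraNneq ac => h.
  by rewrite -a0E -c0E -!rmorphM h.
Qed.

Theorem theorem4p2 (D : unitRingType) (hdiv : is_division_ring D)
  (hwlf : weakly_locally_finite D) (H : D -> Prop)
  (hH : almost_subnormal H) (hnc : ~ (forall x, H x -> central x)) :
  contains_noncyclic_free H.
Proof.
have [a [Ha [c ac]]] : exists a, H a /\ exists c, a * c != c * a.
  apply: contrapT => no_a; apply: hnc => a Ha c; apply/eqP; apply: contrapT => /negP ac.
  by apply: no_a; exists a; split=> //; exists c.
have [R [T [m [m' [eps [x [y pp]]]]]]] := wlf_pingpong hdiv hwlf ac.
have [g1 Hg1 h1] := hyperbolic_subnormal pp true Ha hdiv hH.
have [g2 Hg2 h2] := hyperbolic_subnormal pp false Ha hdiv hH.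
exact: (pingpong_free pp Hg1 Hg2 h1 h2).
Qed.
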